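(* For every $n\ge 2$ the genus distributions of the circular ladder $CL_n$ and of the Möbius ladder $ML_n$ are unimodal, and their peaks $p_{CL}(n)$ and $p_{ML}(n)$ satisfy $$p_{CL}(n)=p_{ML}(n)=\begin{cases}\Big[\dfrac{n}{2}\Big], & 2\le n\le 5,\\[2mm] \Big[\dfrac{n+1}{3}\Big]+1, & 6\le n\le 16,\\[2mm] \Big[\dfrac{n+2}{3}\Big]+1, & n\ge 17.\end{cases}$$
   Context: $[x]$ denotes the largest integer not exceeding $x$. The circular ladder $CL_n$ consists of two disjoint $n$-cycles $u_1\cdots u_n$ and $v_1\cdots v_n$ together with the rungs $u_lv_l$, $1\le l\le n$ (for $n=2$ the cycles are 2-cycles, i.e. pairs of parallel edges). The Möbius ladder $ML_n$ is a $2n$-cycle together with the $n$ chords joining antipodal vertices. For a graph $G$, $g_i(G)$ is the number of 2-cell embeddings of $G$ on the orientable surface of genus $i$ (embeddings counted as rotation systems), and the genus distribution of $G$ is the sequence $g_\gamma(G),g_{\gamma+1}(G),\dots,g_{\gamma_M}(G)$ with $\gamma,\gamma_M$ the minimum and maximum genus of $G$. A finite sequence of nonnegative numbers $\{a_i\}_{i=q}^n$ is unimodal if $a_q\le\cdots\le a_{l-1}<a_l=\cdots=a_m>a_{m+1}\ge\cdots\ge a_n$ for some $q\le l\le m\le n$; if $l=m$, then $m$ is called the peak (indices are genera). *)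

(* Defs.v *)
From mathcomp Require Import all_boot all_fingroup.

Set Implicit Arguments.
Unset Strict Implicit.
Unset Printing Implicit Defensive.

(* Finite multigraphs: parallel edges are allowed, as needed for the two
   2-cycles of the circular ladder with n = 2. *)
Record mgraph := MGraph {
  vert : finType;
  edge : finType;
  ends : edge -> vert * vert }.

Section Embeddings.
Variable G : mgraph.

(* Each edge e has two half-edges: (e, false), attached to the first end of e,
   and (e, true), attached to the second one. *)
Definition dart : finType := (edge G * bool)%type.

Definition origin (d : dart) : vert G :=
  if d.2 then (ends d.1).2 else (ends d.1).1.

Definition flip (d : dart) : dart := (d.1, ~~ d.2).

Lemma flip_inj : injective flip.
Proof. by apply: (can_inj (g := flip)) => -[e b]; rewrite /flip /= negbK. Qed.

Definition flip_perm : {perm dart} := perm flip_inj.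

(* A rotation system is a cyclic ordering of the half-edges at each vertex; it
   is encoded as one permutation of the half-edges, whose cycles are exactly
   the sets of half-edges with a common origin. *)
Definition is_rotation (s : {perm dart}) : bool :=
  [forall d : dart, porbit s d == [set d' | origin d' == origin d]].

(* The facial walks of the embedding given by s are the cycles of the
   permutation sending a half-edge d to s (flip d): products in {perm _} are
   composed from left to right. *)
Definition faces (s : {perm dart}) : {set {set dart}} := porbits (flip_perm * s)%g.

(* Euler's formula #V - #E + #F = 2 - 2 i, in subtraction-free form. It
   characterizes the genus of the surface for connected G with an edge. *)
Definition has_genus (s : {perm dart}) (i : nat) : bool :=
  #|vert G| + #|faces s| + 2 * i == #|edge G| + 2.

Definition genus_count (i : nat) : nat :=
  #|[set s : {perm dart} | is_rotation s && has_genus s i]|.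

Definition is_min_genus (q : nat) : Prop :=
  0 < genus_count q /\ forall i, 0 < genus_count i -> q <= i.

Definition is_max_genus (r : nat) : Prop :=
  0 < genus_count r /\ forall i, 0 < genus_count i -> i <= r.

End Embeddings.

(* a_q <= ... <= a_{l-1} < a_l = ... = a_m > a_{m+1} >= ... >= a_r; the strict
   inequalities are void when l = q, respectively m = r. *)
Definition unimodal_at (a : nat -> nat) (q r l m : nat) : Prop :=
  q <= l <= m /\ m <= r /\
  (forall i, q <= i -> i.+1 < l -> a i <= a i.+1) /\
  (q < l -> a l.-1 < a l) /\
  (forall i, l <= i <= m -> a i = a l) /\
  (m < r -> a m.+1 < a m) /\
  (forall i, m < i < r -> a i.+1 <= a i).

Definition unimodal (a : nat -> nat) (q r : nat) : Prop :=
  exists l m, unimodal_at a q r l m.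

Definition is_peak (a : nat -> nat) (q r p : nat) : Prop :=
  unimodal_at a q r p p.

Definition genus_unimodal (G : mgraph) : Prop :=
  exists q r, [/\ is_min_genus G q, is_max_genus G r
                & unimodal (@genus_count G) q r].

Definition genus_peak (G : mgraph) (p : nat) : Prop :=
  exists q r, [/\ is_min_genus G q, is_max_genus G r
                & is_peak (@genus_count G) q r p].

(* ordS is the cyclic successor on 'I_n. The vertices (false, l) and (true, l)
   stand for u_l and v_l, the edge inl (b, l) joins (b, l) to (b, l + 1), and
   inr l is the l-th rung. *)
Definition CL (n : nat) : mgraph :=
  @MGraph (bool * 'I_n)%type (bool * 'I_n + 'I_n)%type
    (fun e => match e with
              | inl (b, l) => ((b, l), (b, ordS l))
              | inr l => ((false, l), (true, l))
              end).

(* The chord inr l joins l to its antipode l + n on the cycle of length 2n. *)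
Definition ML (n : nat) : mgraph :=
  @MGraph 'I_(n + n) ('I_(n + n) + 'I_n)%type
    (fun e => match e with
              | inl l => (l, ordS l)
              | inr l => (lshift n l, rshift n l)
              end).

Definition ladder_peak (n : nat) : nat :=
  if n <= 5 then n %/ 2
  else if n <= 16 then (n + 1) %/ 3 + 1
  else (n + 2) %/ 3 + 1.

(* Main.v *)
(** The number N ^ #faces of a rotation system counts the colourings of the
    half-edges by N colours which are constant along facial walks. Summing over
    all rotation systems of a ladder first, and over the colourings last, the
    choices at the vertices decouple, and the sum becomes the trace of T ^ n for
    CL_n and of w * T ^ n for ML_n. Here T = s + t + e + f acts on the N ^ 4
    colourings of a cross-section, the four terms coming from the four pairs of
    rotations at the ends of a rung: s and t swap two colours, e and f are
    cup-cap operators (they span part of a walled Brauer algebra), and w = s * t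
    exchanges the two tracks. The relations in this algebra make the traces
    linear recurrent, with eigenvalues the roots of y^2 = 2 N y + 8 and of
    y^2 = N y + 8 together with N, 2 and -2, so that

      2 tr = 2 X_n + 2 (N^2 - 1) Y_n + (terms in 2^n, (-2)^n) +- 2 (N^2 - 1) N^n

    for Lucas sequences X and Y. Extracting the coefficient of N^(n + 2 - 2 i)
    gives, with l(n, j) = n / (n - j) * 'C(n - j, j),

      g_i = (2^(n + i - 1) - 8^(i - 1)) l(n, i - 1) + 8^i l(n, i) + small terms.

    For i = j + 1 the leading terms 2^(n + j) l(n, j) and
    2^(n + j + 1) l(n, j + 1) compare like 0 and (r - 1) (n + r - 1), where
    r = n - 3 j; in the case of equality r = 1 the terms in powers of 8 decide,
    which is what produces the exceptional range n <= 16. *)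

Require Import Defs.
From Stdlib Require Import ZArith.
From mathcomp Require Import all_boot all_fingroup all_order all_algebra.
From mathcomp Require Import ring zify ssrZ.

Set Implicit Arguments.
Unset Strict Implicit.
Unset Printing Implicit Defensive.
Import Order.TTheory GRing.Theory Num.Theory.

(** * Colourings constant along the cycles of a permutation *)

Section Colorings.
Variables (T : finType) (f : {perm T}) (N : nat).

Definition orbit_coloring (g : {ffun {A | A \in porbits f} -> 'I_N}) :
  {ffun T -> 'I_N} :=
  [ffun x => g (exist _ (porbit f x) (imset_f (porbit f) (isT : x \in T)))].

(** Invariance under [f] is constancy on cycles, so [orbit_coloring] is a bijection from free
    choices of one colour per cycle onto the invariant colourings. *)
Lemma card_invariant_colorings :
  #|[set c : {ffun T -> 'I_N} | [forall x, c (f x) == c x]]| = N ^ #|porbits f|.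
Proof.
have <- : #|{: {ffun {A | A \in porbits f} -> 'I_N}}| = N ^ #|porbits f|.
  by rewrite card_ffun card_ord card_sig.
rewrite -(card_imset (f := orbit_coloring)); last first.
  move=> g1 g2 /ffunP eq_g; apply/ffunP => -[A PA].
  have /imsetP[x _ defA] := PA.
  have := eq_g x; rewrite !ffunE.
  by congr (g1 _ = g2 _); apply: val_inj; rewrite /= defA.
apply: eq_card => c; rewrite inE; apply/forallP/imsetP => [inv_c | [g _ ->] x].
  have inv_orbit x y : y \in porbit f x -> c y = c x.
    case/porbitP=> i ->; elim: i => [|i IHi]; first by rewrite expg0 perm1.
    by rewrite expgSr permM (eqP (inv_c _)).
  have reprP (A : {A | A \in porbits f}) : exists x, val A == porbit f x.
    by case: A => A /= /imsetP[x _ ->]; exists x.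
  (* The preimage of [c] reads its value at a chosen representative of each cycle. *)
  exists [ffun A => c (xchoose (reprP A))] => //.
  apply/ffunP => x; rewrite !ffunE; apply: inv_orbit.
  by rewrite -eq_porbit_mem; apply: (xchooseP (reprP _)).
rewrite !ffunE; apply/eqP; congr (g _); apply: val_inj => /=.
by apply/eqP; rewrite eq_porbit_mem; have := mem_porbit f 1 x; rewrite expg1.
Qed.

End Colorings.

(** Each point moves to its successor or its predecessor, and the first move fixes the direction:
    turning back would create a point of period two. *)
Lemma step3_cases (t : 'I_3 -> 'I_3) :
  (forall k, t k != k) -> (forall k, t (t k) != k) ->
  t =1 @ordS 3 \/ t =1 @ord_pred 3.
Proof.
move=> t1 t2.
have tSP k : t k = ordS k \/ t k = ord_pred k.
  move: (t1 k) => {t1 t2}; case: (t k) => m; case: k => k /=.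
  move=> lt_k lt_m neq_mk.
  have [] : (m == k.+1 %% 3) \/ (m == (k + 3).-1 %% 3).
  - by case: k m lt_k lt_m neq_mk => [|[|[|k]]] [|[|[|m]]] //=; auto.
  - by move/eqP=> def_m; left; apply: val_inj.
  by move/eqP=> def_m; right; apply: val_inj.
have stepS k : t k = ordS k -> t (ordS k) = ordS (ordS k).
  move=> tk; case: (tSP (ordS k)) => // tSk.
  by case/eqP: (t2 k); rewrite tk tSk ordSK.
have stepP k : t k = ord_pred k -> t (ord_pred k) = ord_pred (ord_pred k).
  move=> tk; case: (tSP (ord_pred k)) => // tSk.
  by case/eqP: (t2 k); rewrite tk tSk ord_predK.
have iterE (u : 'I_3 -> 'I_3) (k : 'I_3) : u = @ordS 3 \/ u = @ord_pred 3 -> 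
    [\/ k = ord0, k = u ord0 | k = u (u ord0)].
  case=> ->; case: k => [[|[|[|k]]] lt_k] //.
  - by apply: Or31; apply: val_inj.
  - by apply: Or32; apply: val_inj.
  - by apply: Or33; apply: val_inj.
  - by apply: Or31; apply: val_inj.
  - by apply: Or33; apply: val_inj.
  - by apply: Or32; apply: val_inj.
case: (tSP ord0) => t0; [left | right] => k.
  have [|->|->|->] // := iterE (@ordS 3) k; first by left.
    exact: stepS.
  by apply/stepS/stepS.
have [|->|->|->] // := iterE (@ord_pred 3) k; first by right.
  exact: stepP.
by apply/stepP/stepP.
Qed.

(** * Rotation systems of a cubic graph whose half-edges at each vertex are labelled by ['I_3]
    through [h] *)

Section Cubic.
Variables (G : mgraph) (h : vert G * 'I_3 -> dart G).
Hypothesis h_bij : bijective h.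
Hypothesis origin_h : forall v k, origin (h (v, k)) = v.

Definition turn (b : bool) : 'I_3 -> 'I_3 := if b then @ordS 3 else @ord_pred 3.

Lemma turn_inj b : injective (turn b).
Proof. by case: b; [apply: ordS_inj | apply: ord_pred_inj]. Qed.

Definition turn_dart (b : {ffun vert G -> bool}) (x : vert G * 'I_3) :=
  (x.1, turn (b x.1) x.2).

Lemma exists_rotation (b : {ffun vert G -> bool}) :
  exists s : {perm dart G}, [forall x, s (h x) == h (turn_dart b x)].
Proof.
have [g hK gK] := h_bij.
have s_inj : injective (fun d => h (turn_dart b (g d))).
  move=> d1 d2 /(bij_inj h_bij) [] eq1.
  rewrite eq1 => /turn_inj eq2.
  by apply: (can_inj gK); rewrite [g d1]surjective_pairing eq1 eq2 -surjective_pairing.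
by exists (perm s_inj); apply/forallP => x; rewrite permE hK.
Qed.

Definition rotation b := xchoose (exists_rotation b).

Lemma rotationE b x : rotation b (h x) = h (turn_dart b x).
Proof. exact/eqP/(forallP (xchooseP (exists_rotation b))). Qed.

Lemma rotation_inj : injective rotation.
Proof.
move=> b1 b2 eq_b; apply/ffunP => v.
have := rotationE b1 (v, ord0); rewrite eq_b rotationE => /(bij_inj h_bij) [].
by rewrite /turn_dart /=; case: (b1 v) (b2 v) => [] [].
Qed.

(** Three half-edges have exactly two cyclic orders, so a rotation system amounts to one bit per
    vertex. *)
Lemma is_rotationE s : is_rotation s = (s \in [set rotation b | b in predT]).
Proof.
apply/forallP/imsetP => [rot_s | [b _ ->] d]; last first.
  have [g hK gK] := h_bij.
  apply/eqP/setP => d'; rewrite inE; apply/idP/eqP.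
    case/porbitP=> i ->; elim: i => [|i IHi]; first by rewrite expg0 perm1.
    rewrite expgSr permM -IHi.
    move: (fun_of_perm _ d) => d1; rewrite -[d1]gK rotationE.
    by case: (g d1) => v k; rewrite /turn_dart !origin_h.
  rewrite -[d']gK -[d]gK; case: (g d) => v k; case: (g d') => v' k'.
  rewrite !origin_h => ->.
  have [i ->] : exists i, k' = iter i (turn (b v)) k.
    rewrite /turn; case: (b v); case: k k' => [[|[|[|k]]] lt_k] // [[|[|[|k']]] lt_k'] //;
    solve [ by exists 0; apply: val_inj | by exists 1; apply: val_inj
          | by exists 2; apply: val_inj ].
  apply/porbitP; exists i; elim: i => [|i IHi]; first by rewrite expg0 perm1.
  by rewrite expgSr permM -IHi rotationE.
have [g hK gK] := h_bij.
have orb d d' : (d' \in porbit s d) = (origin d' == origin d).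
  by rewrite (eqP (rot_s d)) inE.
(* Period two would leave at most two elements in the orbit of [d], which contains the three
   half-edges at its origin. *)
have no_period2 d : s (s d) != d.
  apply/eqP=> sd; have: #|porbit s d| <= #|[set d; s d]|.
    apply/subset_leq_card/subsetP=> _ /porbitP[i ->]; rewrite !inE.
    elim: i => [|i]; first by rewrite expg0 perm1 eqxx.
    by rewrite expgSr permM => /orP[] /eqP->; rewrite ?sd eqxx ?orbT.
  rewrite (eqP (rot_s d)) cards2 => le_card.
  have: #|[set h ((g d).1, k) | k in 'I_3]| <= (d != s d).+1.
    apply: leq_trans le_card; apply/subset_leq_card/subsetP=> _ /imsetP[k _ ->].
    by rewrite inE origin_h -{2}[d]gK [g d]surjective_pairing origin_h.
  rewrite card_imset ?card_ord; first by case: (d != s d).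
  by move=> k1 k2 /(bij_inj h_bij) [].
have no_period1 d : s d != d.
  by apply/eqP=> sd; case/eqP: (no_period2 d); rewrite !sd.
pose t v k := (g (s (h (v, k)))).2.
have tE v k : s (h (v, k)) = h (v, t v k).
  rewrite -[LHS]gK [g _]surjective_pairing; congr (h (_, _)).
  have: s (h (v, k)) \in porbit s (h (v, k)) by have := mem_porbit s 1 (h (v, k)); rewrite expg1.
  by rewrite orb origin_h -{1}[s _]gK [g _]surjective_pairing origin_h => /eqP.
have t_cases v : t v =1 turn (t v ord0 == ordS ord0).
  have [t_S | t_P] : t v =1 @ordS 3 \/ t v =1 @ord_pred 3.
  - apply: step3_cases => k; apply/eqP.
      by move=> tk; case/eqP: (no_period1 (h (v, k))); rewrite tE tk.
    by move=> tk; case/eqP: (no_period2 (h (v, k))); rewrite !tE tk.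
  - by move=> k; rewrite /turn (t_S ord0) eqxx t_S.
  by move=> k; rewrite /turn (t_P ord0) t_P.
exists [ffun v => t v ord0 == ordS ord0] => //.
apply/permP=> d; rewrite -[d]gK; case: (g d) => v k.
by rewrite tE rotationE /turn_dart ffunE t_cases.
Qed.

(* Given a colouring, the compatible rotations can be chosen independently at
   each vertex. *)
Lemma sum_rotations N :
  \sum_(s : {perm dart G} | is_rotation s) N ^ #|faces s| =
  \sum_(c : {ffun dart G -> 'I_N}) \prod_v \sum_(b : bool)
     [forall k, c (h (v, turn b k)) == c (flip (h (v, k)))].
Proof.
under eq_bigl => s do rewrite is_rotationE.
rewrite big_imset /=; last by move=> b1 b2 _ _ /rotation_inj.
transitivity (\sum_(b : {ffun vert G -> bool}) \sum_(c : {ffun dart G -> 'I_N})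
    \prod_v [forall k, c (h (v, turn (b v) k)) == c (flip (h (v, k)))] : nat).
  apply: eq_bigr => b _; rewrite -card_invariant_colorings -sum1_card big_mkcond /=.
  apply: eq_bigr => c _; rewrite inE.
  transitivity ([forall v, forall k, c (h (v, turn (b v) k)) == c (flip (h (v, k)))] : nat).
    congr (nat_of_bool _); have [g hK gK] := h_bij.
    (* As [flip] is an involution, invariance can be tested at the darts [flip (h (v, k))], where
       the face permutation reduces to the rotation at [v]. *)
    have flipK : involutive (@flip G) by case=> e x; rewrite /flip /= negbK.
    apply/forallP/forallP=> [inv_c v | inv_c d].
      apply/forallP=> k; rewrite -(eqP (inv_c (flip (h (v, k))))) permM permE flipK.
      by rewrite rotationE.
    rewrite permM permE -[flip d]gK; case def_d: (g (flip d)) => [v k].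
    rewrite rotationE /turn_dart (eqP (forallP (inv_c v) k)).
    by rewrite -def_d gK flipK.
  pose P v := [forall k, c (h (v, turn (b v) k)) == c (flip (h (v, k)))].
  have ->: [forall v, [forall k, c (h (v, turn (b v) k)) == c (flip (h (v, k)))]] =
           \big[andb/true]_v P v.
    by rewrite big_andE; apply: eq_forallb => v.
  rewrite (big_morph nat_of_bool (id1 := 1) (op1 := muln)) //.
  by move=> x y; rewrite mulnb.
rewrite exchange_big; apply: eq_bigr => c _ /=.
by rewrite bigA_distr_bigA.
Qed.

End Cubic.

Local Open Scope ring_scope.

(** * Kernels as matrices and closed walks *)

Section Kernels.
Variable S : finType.
Implicit Types K L : S -> S -> int.

Definition kermat K : 'M[int]_#|S| := \matrix_(i, j) K (enum_val i) (enum_val j).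

Definition kercomp K L x y := \sum_z K x z * L z y.

Lemma kermatM K L : kermat K *m kermat L = kermat (kercomp K L).
Proof.
apply/matrixP=> i j; rewrite !mxE /kercomp (reindex (@enum_val S S)) /=; last first.
  exact/onW_bij/enum_val_bij.
by apply: eq_bigr => k _; rewrite !mxE.
Qed.

Lemma kermatD K L : kermat K + kermat L = kermat (fun x y => K x y + L x y).
Proof. by apply/matrixP=> i j; rewrite !mxE. Qed.

Lemma eq_kermat K L : K =2 L -> kermat K = kermat L.
Proof. by move=> eqKL; apply/matrixP=> i j; rewrite !mxE eqKL. Qed.

Lemma kermat1 : kermat (fun x y => (x == y)%:R) = 1%:M.
Proof. by apply/matrixP=> i j; rewrite !mxE (inj_eq enum_val_inj). Qed.

Lemma kermatZ (a : int) K : a *: kermat K = kermat (fun x y => a * K x y).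
Proof. by apply/matrixP=> i j; rewrite !mxE. Qed.

Lemma kermat_trace K : \tr (kermat K) = \sum_x K x x.
Proof.
rewrite /mxtrace (reindex (@enum_val S S)) /=; last exact/onW_bij/enum_val_bij.
by apply: eq_bigr => i _; rewrite mxE.
Qed.

Fixpoint kerpow K n x y : int :=
  if n is m.+1 then \sum_z K x z * kerpow K m z y else (x == y)%:R.

Lemma kermatX K n : kermat (kerpow K n) = kermat K ^+ n.
Proof.
elim: n => [|n IHn]; first by rewrite expr0 kermat1.
by rewrite exprS -IHn -mulmxE kermatM.
Qed.

Definition ffun_cons n (a : S) (y : {ffun 'I_n -> S}) : {ffun 'I_n.+1 -> S} :=
  [ffun i => if unlift ord0 i is Some j then y j else a].

Lemma sum_ffun_cons n (F : {ffun 'I_n.+1 -> S} -> int) :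
  \sum_y F y = \sum_a \sum_(y : {ffun 'I_n -> S}) F (ffun_cons a y).
Proof.
rewrite pair_bigA /= (reindex (fun p : S * {ffun 'I_n -> S} => ffun_cons p.1 p.2)) //.
apply: onW_bij; exists (fun y : {ffun _ -> _} => (y ord0, [ffun i => y (lift ord0 i)])).
  move=> [a y]; congr (_, _); first by rewrite ffunE unlift_none.
  by apply/ffunP=> i; rewrite !ffunE liftK.
move=> y; apply/ffunP=> i; rewrite ffunE /=.
by case: unliftP => [j|] ->; rewrite ?ffunE.
Qed.

(** The arbitrary weight [psi] on the two ends makes the induction work: the first step of the path
    is absorbed into it. *)
Lemma sum_paths K n (psi : S -> S -> int) :
  \sum_(y : {ffun 'I_n.+1 -> S}) psi (y ord0) (y ord_max) *
      \prod_(l < n) K (y (widen_ord (leqnSn n) l)) (y (lift ord0 l)) =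
  \sum_a \sum_b psi a b * kerpow K n a b.
Proof.
elim: n psi => [|n IHn] psi.
  rewrite sum_ffun_cons; apply: eq_bigr => a _.
  rewrite (bigD1 a) //= eqxx mulr1 [X in _ + X]big1 ?addr0; last first.
    by move=> b; rewrite eq_sym => /negPf->; rewrite mulr0.
  rewrite (eq_bigr (fun=> psi a a)); last first.
    move=> y _; rewrite big_ord0 mulr1 (_ : ord_max = ord0); last exact: val_inj.
    by rewrite !ffunE unlift_none.
  by rewrite sumr_const card_ffun card_ord expn0.
rewrite sum_ffun_cons; apply: eq_bigr => a _.
pose psi' c b := psi a b * K a c.
transitivity (\sum_c \sum_b psi' c b * kerpow K n c b).
  rewrite -IHn; apply: eq_bigr => y _; rewrite big_ord_recl.
  have consS i : ffun_cons a y (lift ord0 i) = y i by rewrite ffunE liftK.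
  have cons0 : ffun_cons a y ord0 = a by rewrite ffunE unlift_none.
  rewrite consS (_ : widen_ord _ ord0 = ord0) ?cons0; last exact: val_inj.
  rewrite (_ : ord_max = lift ord0 ord_max) ?consS; last exact: val_inj.
  rewrite /psi' !mulrA; congr (_ * _); apply: eq_bigr => l _.
  rewrite consS; congr (K _ _); rewrite -consS; congr (ffun_cons _ _ _).
  exact: val_inj.
rewrite exchange_big; apply: eq_bigr => b _ /=.
by rewrite big_distrr; apply: eq_bigr => c _; rewrite /psi' /= mulrA.
Qed.

(* The closing map [w] describes how the last cross-section is glued to the
   first one. *)
Lemma sum_cycles K n (w : S -> S) :
  \sum_(y : {ffun 'I_n.+1 -> S}) K (w (y ord_max)) (y ord0) *
      \prod_(l < n) K (y (widen_ord (leqnSn n) l)) (y (lift ord0 l)) =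
  \tr (kermat (fun x y => (y == w x)%:R) *m kermat K ^+ n.+1).
Proof.
rewrite (sum_paths K n (fun a b => K (w b) a)) exprS mulmxA -kermatX !kermatM.
rewrite kermat_trace exchange_big; apply: eq_bigr => b _; apply: eq_bigr => a _.
congr (_ * _); rewrite /kercomp (bigD1 (w b)) //= eqxx mul1r big1 ?addr0 //.
by move=> c /negPf->; rewrite mul0r.
Qed.

End Kernels.

(** * Traces in the ladder algebra *)

Section Lucas.
Variable R : comPzRingType.
Implicit Type c : R.

(** Sum of the [k]-th powers of the two roots of [y^2 = c y + 8]. *)
Fixpoint lucas c k : R :=
  if k is k1.+1 then if k1 is k2.+1 then c * lucas c k1 + 8 * lucas c k2 else c else 2.

Lemma lucasSS c k : lucas c k.+2 = c * lucas c k.+1 + 8 * lucas c k.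
Proof. by []. Qed.

(* Twice 2^k c^2 (c - 1) (c + 3) / 4 + (-2)^k c^2 (c + 1) (c - 3) / 4, the
   contribution of the eigenvalues 2 and -2. *)
Fixpoint pm2_part c k : R :=
  if k is k1.+1 then if k1 is k2.+1 then 4 * pm2_part c k2 else 4 * c ^+ 3
  else c ^+ 4 - 3 * c ^+ 2.

Lemma pm2_partSS c k : pm2_part c k.+2 = 4 * pm2_part c k.
Proof. by []. Qed.

End Lucas.

(* The relations between [cap = e + f], [swp = s + t], [w = s * t] and [g = e * f].
   The trace splits along the central involution [w]: [rung] acts as [cap] on the
   part [w = -1], and the recurrences are computed on the part [w = 1]. *)
Section LadderAlgebra.
Variables (R : pzRingType) (N : nat) (cap swp w g : R).
Hypotheses (ww : w * w = 1) (cap_w : cap * w = w * cap).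
Hypotheses (swp_w : swp * w = swp) (w_swp : w * swp = swp).
Hypotheses (wg : w * g = g) (gw : g * w = g).
Hypothesis swp_sqr : swp * swp = (1 + w) *+ 2.
Hypothesis cap_sqr : cap * cap = cap *+ N + g *+ 2.
Hypothesis cap_swp_cap : cap * swp * cap = (cap * (1 + w)) *+ 2.
Hypothesis cap_g : cap * g = g *+ (2 * N).
Hypothesis cap_swp_g : cap * swp * g = g *+ 4.
Variable tau : {additive R -> int}.
Hypothesis tauC : forall x y, tau (x * y) = tau (y * x).
Let n := N%:R : int.

Variable rung : R.
Hypothesis rungE : rung = cap + swp.

Lemma rung_w : rung * w = w * rung.
Proof. by rewrite rungE mulrDl mulrDr cap_w swp_w w_swp. Qed.

Lemma wg2 : (1 + w) * g = g *+ 2.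
Proof. by rewrite mulrDl mul1r wg. Qed.

Lemma gw2 : g * (1 + w) = g *+ 2.
Proof. by rewrite mulrDr mulr1 gw. Qed.

Lemma rung_capE : rung * cap = cap *+ N + g *+ 2 + swp * cap.
Proof. by rewrite rungE mulrDl cap_sqr. Qed.

(** The span of [g] and [swp * g] is stable under [rung], with characteristic equation
    [y^2 = 2 N y + 8]. *)
Lemma rung2_g : rung * (rung * g) = (rung * g) *+ (2 * N) + g *+ 8.
Proof.
have rung_g : rung * g = g *+ (2 * N) + swp * g by rewrite rungE mulrDl cap_g.
have rung_swp : rung * (swp * g) = g *+ 8.
  by rewrite rungE mulrDl !mulrA cap_swp_g swp_sqr mulrnAl wg2 -mulrnA -mulrnDr.
by rewrite {1}rung_g mulrDr mulrnAr rung_swp.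
Qed.

Definition cap_sym := cap * (1 + w).

Lemma sym_sqr : (1 + w) * (1 + w) = (1 + w) *+ 2.
Proof. by rewrite mulrDr mulr1 mulrDl mul1r ww [w + 1]addrC mulr2n. Qed.

(** The relation [y^2 = N y + 8] on the span of [cap_sym] and [swp * cap_sym], up to a term in [g]
    that [cap_sqr] produces. *)
Lemma rung2_cap : rung * (rung * cap_sym) =
  (rung * cap_sym) *+ N + cap_sym *+ 8 + (rung * g) *+ 4.
Proof.
have w_cap_sym : (1 + w) * cap_sym = cap_sym *+ 2.
  rewrite /cap_sym mulrA mulrDl mul1r -cap_w -{1}[cap]mulr1 -mulrDr -mulrA sym_sqr.
  by rewrite mulrnAr.
have rung_capS : rung * cap_sym = cap_sym *+ N + g *+ 4 + swp * cap_sym.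
  rewrite [LHS]mulrA rung_capE 2!mulrDl !mulrnAl gw2 -mulrnA -mulrA //.
have rung_swp : rung * (swp * cap_sym) = cap_sym *+ 8.
  rewrite rungE mulrDl (mulrA swp swp) swp_sqr mulrnAl w_cap_sym.
  rewrite /cap_sym !mulrA cap_swp_cap mulrnAl -mulrA sym_sqr mulrnAr.
  by rewrite -!mulrnA -mulrnDr.
rewrite {1}rung_capS 2!mulrDr !mulrnAr rung_swp.
exact: addrAC.
Qed.

(** This is [(rung - cap)^2 = swp^2 = 4] on the part [w = 1], with negative terms moved across; it
    is the source of the eigenvalues 2 and -2. *)
Lemma rung2 : rung * rung * (1 + w) + cap_sym *+ N + g *+ 4 =
  rung * cap_sym + cap * rung * (1 + w) + (1 + w) *+ 4.
Proof.
have cap_cap_sym : cap * cap_sym = cap_sym *+ N + g *+ 4.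
  by rewrite /cap_sym mulrA cap_sqr mulrDl !mulrnAl gw2 -mulrnA.
have swp_sqr' : swp * swp * (1 + w) = (1 + w) *+ 4.
  by rewrite swp_sqr mulrnAl sym_sqr -mulrnA.
rewrite -addrA -cap_cap_sym -swp_sqr' /cap_sym !mulrA -!mulrDl; congr (_ * _).
have -> : rung * rung = rung * cap + (cap * swp + swp * swp).
  by rewrite -mulrDl -rungE -mulrDr -rungE.
have -> : cap * rung = cap * cap + cap * swp by rewrite -mulrDr -rungE.
by rewrite -!addrA; congr (_ + _); rewrite addrA addrC.
Qed.

Definition tr_sym k := tau (rung ^+ k * (1 + w)).
Definition tr_cap k := tau (rung ^+ k * cap_sym).
Definition tr_g k := tau (rung ^+ k * g).

Let tr_scale k X m : tau (rung ^+ k * (X *+ m)) = m%:R * tau (rung ^+ k * X).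
Proof. by rewrite mulrnAr raddfMn /= mulr_natl. Qed.

Let tr_add k X Y :
  tau (rung ^+ k * (X + Y)) = tau (rung ^+ k * X) + tau (rung ^+ k * Y).
Proof. by rewrite mulrDr raddfD. Qed.

Let tr_rung1 k X : tau (rung ^+ k * (rung * X)) = tau (rung ^+ k.+1 * X).
Proof. by rewrite exprSr mulrA. Qed.

Lemma tr_g_rec k : tr_g k.+2 = 2 * n * tr_g k.+1 + 8 * tr_g k.
Proof.
rewrite /tr_g -!tr_rung1 rung2_g tr_add 2!tr_scale natrM.
by [].
Qed.

Lemma tr_cap_rec k : tr_cap k.+2 = n * tr_cap k.+1 + 8 * tr_cap k + 4 * tr_g k.+1.
Proof.
by rewrite /tr_cap /tr_g -!tr_rung1 rung2_cap 2!tr_add 3!tr_scale.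
Qed.

Lemma tr_sym_rec k :
  tr_sym k.+2 = 4 * tr_sym k + 2 * tr_cap k.+1 - n * tr_cap k - 4 * tr_g k.
Proof.
have := congr1 (fun X => tau (rung ^+ k * X)) rung2.
rewrite /= 4!tr_add 3!tr_scale -/(tr_cap k) -/(tr_g k) -/(tr_sym k).
have -> : tau (rung ^+ k * (rung * rung * (1 + w))) = tr_sym k.+2.
  by rewrite -mulrA 2!tr_rung1.
have -> : tau (rung ^+ k * (rung * cap_sym)) = tr_cap k.+1.
  by rewrite tr_rung1.
(* By cyclicity of [tau], and because [rung] commutes with [1 + w], the second cross term has the
   same trace as the first. *)
have -> : tau (rung ^+ k * (cap * rung * (1 + w))) = tr_cap k.+1.
  have comm_rung : rung * (1 + w) = (1 + w) * rung.
    by rewrite mulrDr mulrDl mulr1 mul1r rung_w.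
  rewrite -mulrA comm_rung (mulrA cap) (mulrA (rung ^+ k)) tauC mulrA -exprS.
  by [].
move=> eq_tr; apply: (addIr (n * tr_cap k + 4 * tr_g k)); rewrite addrA eq_tr; ring.
Qed.

(** [swp] and [g] kill [1 - w], so [rung] acts there as [cap], and [cap^2 = N cap]. *)
Lemma rung_skew k : rung ^+ k.+1 * (1 - w) = (cap * (1 - w)) *+ N ^ k.
Proof.
have swp_skew : swp * (1 - w) = 0 by rewrite mulrBr mulr1 swp_w subrr.
have g_skew : g * (1 - w) = 0 by rewrite mulrBr mulr1 gw subrr.
have cap_skew : rung * (1 - w) = cap * (1 - w).
  by rewrite rungE mulrDl swp_skew addr0.
elim: k => [|k IHk]; first by rewrite expr1.
have comm_cap : cap * (1 - w) = (1 - w) * cap.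
  by rewrite mulrBr mulrBl mulr1 mul1r cap_w.
rewrite exprS -mulrA IHk mulrnAr comm_cap mulrA cap_skew -mulrA -comm_cap mulrA.
by rewrite cap_sqr mulrDl !mulrnAl g_skew mul0rn addr0 -mulrnA -expnS.
Qed.

(** Splits [2 = (1 + w) + (1 - w)]; the twisted version below uses [2 w = (1 + w) - (1 - w)], which
    only changes the sign of the second term. *)
Lemma tr_rung k : 2 * tau (rung ^+ k.+1) = tr_sym k.+1 + n ^+ k * tau (cap * (1 - w)).
Proof.
have -> : n ^+ k * tau (cap * (1 - w)) = tau (rung ^+ k.+1 * (1 - w)).
  by rewrite rung_skew raddfMn /= -natrX mulr_natl.
rewrite /tr_sym -raddfD /= -mulrDr addrCA -addrA subrr addr0 -[1 + 1]/(1 *+ 2).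
by rewrite mulrnAr mulr1 raddfMn /= mulr_natl.
Qed.

Lemma tr_rung_w k :
  2 * tau (w * rung ^+ k.+1) = tr_sym k.+1 - n ^+ k * tau (cap * (1 - w)).
Proof.
have -> : n ^+ k * tau (cap * (1 - w)) = tau (rung ^+ k.+1 * (1 - w)).
  by rewrite rung_skew raddfMn /= -natrX mulr_natl.
rewrite tauC /tr_sym -raddfB /= -mulrBr opprB addrC -addrA.
by rewrite addKr -mulr2n mulrnAr raddfMn /= mulr_natl.
Qed.

Hypotheses (tau1 : tau 1 = n ^+ 4) (tau_w : tau w = n ^+ 2) (tau_g : tau g = n ^+ 2).
Hypotheses (tau_cap : tau cap = 2 * n ^+ 3) (tau_capw : tau (cap * w) = 2 * n).
Hypotheses (tau_swp : tau swp = 2 * n ^+ 3) (tau_swpcap : tau (swp * cap) = 4 * n ^+ 2).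
Hypothesis tau_swpg : tau (swp * g) = 2 * n.

(** Every solution of the recurrence is a combination of [fib c k.+1] and [fib c k], so the closed
    forms below become ring identities. *)
Fixpoint fib (c : int) k : int :=
  if k is k1.+1 then if k1 is k2.+1 then c * fib c k1 + 8 * fib c k2 else 1 else 0.

Lemma fibSS c k : fib c k.+2 = c * fib c k.+1 + 8 * fib c k.
Proof. by []. Qed.

Lemma lucas_fib c k : lucas c k = 2 * fib c k.+1 - c * fib c k.
Proof.
suff: lucas c k = 2 * fib c k.+1 - c * fib c k /\
      lucas c k.+1 = 2 * fib c k.+2 - c * fib c k.+1 by case.
elim: k => [|k [IH0 IH1]]; first by rewrite /=; split; ring.
by split=> //; rewrite lucasSS IH0 IH1 (fibSS c k.+1) (fibSS c k); ring.
Qed.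

Lemma tr_gE k : tr_g k = n ^+ 2 * fib (2 * n) k.+1 + 2 * n * fib (2 * n) k.
Proof.
suff: tr_g k = n ^+ 2 * fib (2 * n) k.+1 + 2 * n * fib (2 * n) k /\
  tr_g k.+1 = n ^+ 2 * fib (2 * n) k.+2 + 2 * n * fib (2 * n) k.+1 by case.
elim: k => [|k [IH0 IH1]].
  rewrite /tr_g expr0 expr1 mul1r rungE (mulrDl cap) cap_g raddfD /= raddfMn /= -(mulr_natl (tau g)).
  by rewrite tau_g tau_swpg natrM; split; rewrite /=; ring.
by split=> //; rewrite tr_g_rec IH0 IH1 (fibSS _ k.+1) (fibSS _ k); ring.
Qed.

Lemma tr_capE k : tr_cap k = 4 * n * fib (2 * n) k.+1 + 8 * fib (2 * n) k +
  (n ^+ 2 - 1) * (2 * n * fib n k.+1 + 8 * fib n k).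
Proof.
have tau_capS : tau cap_sym = 2 * n ^+ 3 + 2 * n.
  by rewrite /cap_sym mulrDr mulr1 raddfD /= tau_cap tau_capw.
suff: tr_cap k = 4 * n * fib (2 * n) k.+1 + 8 * fib (2 * n) k +
        (n ^+ 2 - 1) * (2 * n * fib n k.+1 + 8 * fib n k) /\
      tr_cap k.+1 = 4 * n * fib (2 * n) k.+2 + 8 * fib (2 * n) k.+1 +
        (n ^+ 2 - 1) * (2 * n * fib n k.+2 + 8 * fib n k.+1) by case.
elim: k => [|k [IH0 IH1]].
  rewrite /tr_cap expr0 expr1 mul1r tau_capS; split; first by rewrite /=; ring.
  have -> : rung * cap_sym = cap_sym *+ N + g *+ 4 + swp * cap_sym.
    rewrite [LHS]mulrA rung_capE 2!mulrDl !mulrnAl gw2 -mulrnA -mulrA //.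
  have tau_swpcapS : tau (swp * cap_sym) = 8 * n ^+ 2.
    have w_swp2 : (1 + w) * swp = swp *+ 2 by rewrite mulrDl mul1r w_swp mulr2n.
    rewrite /cap_sym mulrA tauC mulrA w_swp2 (mulrnAl swp) (raddfMn tau) /=.
    by rewrite tau_swpcap -(mulr_natl (4 * _)); ring.
  rewrite 2!raddfD /= !raddfMn /= tau_capS tau_g tau_swpcapS -(mulr_natl (_ + _)).
  rewrite -(mulr_natl (n ^+ 2)) /=; ring.
by split=> //; rewrite tr_cap_rec tr_gE IH0 IH1 !(fibSS _ k.+1) !(fibSS _ k); ring.
Qed.

(** The homogeneous part [y^2 = 4] of the recurrence for [tr_sym] gives [pm2_part]; the two Lucas
    terms are forced by [tr_cap] and [tr_g]. *)
Lemma tr_symE k :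
  tr_sym k = 2 * lucas (2 * n) k + 2 * (n ^+ 2 - 1) * lucas n k + pm2_part n k.
Proof.
suff: tr_sym k = 2 * lucas (2 * n) k + 2 * (n ^+ 2 - 1) * lucas n k + pm2_part n k /\
  tr_sym k.+1 = 2 * lucas (2 * n) k.+1 + 2 * (n ^+ 2 - 1) * lucas n k.+1 +
    pm2_part n k.+1.
  by case.
elim: k => [|k [IH0 IH1]].
  rewrite /tr_sym expr0 expr1 mul1r rungE (mulrDl cap) !(mulrDr _ 1 w) !mulr1 swp_w !raddfD /=.
  by rewrite tau1 tau_w tau_cap tau_capw tau_swp; split; rewrite /= ; ring.
split=> //; rewrite tr_sym_rec IH0 pm2_partSS (tr_gE k) (tr_capE k) (tr_capE k.+1).
by rewrite !lucas_fib !(fibSS _ k.+1) !(fibSS _ k); ring.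
Qed.

Lemma tr_rungE k : 2 * tau (rung ^+ k.+1) =
  2 * lucas (2 * n) k.+1 + 2 * (n ^+ 2 - 1) * lucas n k.+1 + pm2_part n k.+1
  + 2 * (n ^+ 2 - 1) * n ^+ k.+1.
Proof.
rewrite tr_rung tr_symE; congr (_ + _).
by rewrite mulrBr mulr1 raddfB /= tau_cap tau_capw (exprS n k); ring.
Qed.

Lemma tr_rung_wE k : 2 * tau (w * rung ^+ k.+1) =
  2 * lucas (2 * n) k.+1 + 2 * (n ^+ 2 - 1) * lucas n k.+1 + pm2_part n k.+1
  - 2 * (n ^+ 2 - 1) * n ^+ k.+1.
Proof.
rewrite tr_rung_w tr_symE; congr (_ - _).
by rewrite mulrBr mulr1 raddfB /= tau_cap tau_capw (exprS n k); ring.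
Qed.

End LadderAlgebra.

Lemma sum_bool_unique (J : finType) (P : pred J) c : (forall q, P q -> q = c) ->
  \sum_q (P q)%:R = (P c)%:R :> int.
Proof.
move=> Pc; rewrite (bigD1 c) //= big1 ?addr0 // => q neq_qc.
by case Pq: (P q) => //; rewrite (Pc q Pq) eqxx in neq_qc.
Qed.

Ltac split_eqs := repeat match goal with
  | H : is_true (_ && _) |- _ => case/andP: H => ? ?
  | H : is_true (_ == _) |- _ => move/eqP: H => /= ?
  end; subst; rewrite ?eqxx.

(** * The ladder algebra realized by matrices on the colourings of a cross-section *)

Section Ladder.
Variable N : nat.
Let I := 'I_N.
(* The colours of the half-edges at the left and at the right end of the edge of
   the first track, then those of the edge of the second track. *)
Definition state := ((I * I) * (I * I))%type.
Implicit Types a b : state.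
Let n := N%:R : int.

Definition swap_s a : state := ((a.2.1, a.1.2), (a.1.1, a.2.2)).
Definition swap_t a : state := ((a.1.1, a.2.2), (a.2.1, a.1.2)).
Definition swap_w a : state := (a.2, a.1).
(** With the four colours of a state read as strands in order, [ker_e] joins the two middle strands
    on each side and lets the outer ones pass, [ker_f] does the reverse, and [ker_g] joins both
    pairs. *)
Definition ker_e a b : int :=
  [&& a.1.2 == a.2.1, b.1.2 == b.2.1, a.1.1 == b.1.1 & a.2.2 == b.2.2]%:R.
Definition ker_f a b : int :=
  [&& a.1.1 == a.2.2, b.1.1 == b.2.2, a.1.2 == b.1.2 & a.2.1 == b.2.1]%:R.
Definition ker_g a b : int :=
  [&& a.1.2 == a.2.1, a.1.1 == a.2.2, b.1.2 == b.2.1 & b.1.1 == b.2.2]%:R.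

Let M := 'M[int]_#|{: state}|.
Definition graph_mx (w : state -> state) : M := kermat (fun a b => (b == w a)%:R).
Definition mx_s : M := graph_mx swap_s.
Definition mx_t : M := graph_mx swap_t.
Definition mx_w : M := graph_mx swap_w.
Definition mx_e : M := kermat ker_e.
Definition mx_f : M := kermat ker_f.
Definition mx_g : M := kermat ker_g.

Lemma sum_state (F : state -> int) :
  \sum_a F a = \sum_x \sum_x' \sum_z \sum_z' F ((x, x'), (z, z')).
Proof.
transitivity (\sum_p \sum_q F (p, q)).
  by rewrite [RHS]pair_bigA; apply: eq_bigr => -[].
transitivity (\sum_x \sum_x' \sum_q F ((x, x'), q)).
  by rewrite [RHS]pair_bigA; apply: eq_bigr => -[].
do 2 (apply: eq_bigr => ? _).
by rewrite [RHS]pair_bigA; apply: eq_bigr => -[].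
Qed.

Lemma sum_const (c : int) : \sum_(p : I) c = n * c.
Proof. by rewrite sumr_const card_ord mulr_natl. Qed.

Lemma graph_mxM w K : graph_mx w * kermat K = kermat (fun a b => K (w a) b).
Proof.
rewrite -mulmxE kermatM; apply: eq_kermat => a b; rewrite /kercomp.
rewrite (bigD1 (w a)) //= eqxx mul1r big1 ?addr0 // => c /negPf->.
by rewrite mul0r.
Qed.

Lemma mx_eM K : mx_e * kermat K =
  kermat (fun a b => (a.1.2 == a.2.1)%:R * \sum_p K ((a.1.1, p), (p, a.2.2)) b).
Proof.
rewrite -mulmxE kermatM; apply: eq_kermat => a b; rewrite /kercomp sum_state /=.
rewrite /ker_e /= (bigD1 a.1.1) //= [X in _ + X]big1 ?addr0; last first.
  move=> x; rewrite eq_sym => /negPf neq_x; do 3 (apply: big1 => ? _).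
  by rewrite neq_x /= !andbF mul0r.
rewrite mulr_sumr; apply: eq_bigr => p _; rewrite (bigD1 p) //= eqxx /=.
rewrite [X in _ + X]big1 ?addr0; last first.
  move=> z; rewrite eq_sym => /negPf neq_z; apply: big1 => z' _.
  by rewrite neq_z andbF mul0r.
rewrite (bigD1 a.2.2) //= !eqxx !andbT big1 ?addr0 //.
by move=> z'; rewrite eq_sym => /negPf->; rewrite !andbF mul0r.
Qed.

Lemma mx_fM K : mx_f * kermat K =
  kermat (fun a b => (a.1.1 == a.2.2)%:R * \sum_p K ((p, a.1.2), (a.2.1, p)) b).
Proof.
rewrite -mulmxE kermatM; apply: eq_kermat => a b; rewrite /kercomp sum_state /=.
rewrite /ker_f /= mulr_sumr; apply: eq_bigr => p _.
rewrite (bigD1 a.1.2) //= [X in _ + X]big1 ?addr0; last first.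
  move=> x; rewrite eq_sym => /negPf neq_x; do 2 (apply: big1 => ? _).
  by rewrite neq_x /= !andbF mul0r.
rewrite (bigD1 a.2.1) //= [X in _ + X]big1 ?addr0; last first.
  move=> x; rewrite eq_sym => /negPf neq_x; apply: big1 => ? _.
  by rewrite neq_x /= !andbF mul0r.
rewrite (bigD1 p) //= !eqxx !andbT big1 ?addr0 //.
by move=> z'; rewrite eq_sym => /negPf->; rewrite !andbF mul0r.
Qed.

Lemma graph_mx_comp w1 w2 : graph_mx w1 * graph_mx w2 = graph_mx (w2 \o w1).
Proof. by rewrite /graph_mx graph_mxM. Qed.

Lemma graph_mx_id w : w =1 id -> graph_mx w = 1.
Proof.
move=> w_id; apply: etrans (kermat1 _); apply: eq_kermat => a b.
by rewrite w_id eq_sym.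
Qed.

Lemma mx_ww : mx_w * mx_w = 1.
Proof. by rewrite graph_mx_comp graph_mx_id // => -[]. Qed.

Lemma mx_ss : mx_s * mx_s = 1.
Proof. by rewrite graph_mx_comp graph_mx_id // => -[[? ?] [? ?]]. Qed.

Lemma mx_st : mx_s * mx_t = mx_w.
Proof.
by rewrite graph_mx_comp; apply: eq_kermat => -[[? ?] [? ?]].
Qed.

Lemma mx_ts : mx_t * mx_s = mx_w.
Proof.
by rewrite graph_mx_comp; apply: eq_kermat => -[[? ?] [? ?]].
Qed.

Lemma mx_Mgraph K w : involutive w ->
  kermat K * graph_mx w = kermat (fun a b => K a (w b)).
Proof.
move=> wK; rewrite -mulmxE kermatM; apply: eq_kermat => a b; rewrite /kercomp.
rewrite (bigD1 (w b)) //= wK eqxx mulr1 big1 ?addr0 // => c.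
by rewrite -(inj_eq (inv_inj wK)) wK eq_sym => /negPf->; rewrite mulr0.
Qed.

Lemma swap_wK : involutive swap_w. Proof. by case. Qed.

Ltac kernel_eq := apply: eq_kermat => -[[? ?] [? ?]] [[? ?] [? ?]];
  rewrite ?/ker_e ?/ker_f ?/ker_g /=.
Ltac bool_eq := congr (_%:R); congr nat_of_bool;
  apply/idP/idP => /and4P[/eqP? /eqP? /eqP? /eqP?]; subst; rewrite ?eqxx.

Lemma mx_we : mx_w * mx_e = mx_f * mx_w.
Proof. by rewrite graph_mxM mx_Mgraph; [kernel_eq; bool_eq | exact: swap_wK]. Qed.

Lemma mx_wg : mx_w * mx_g = mx_g.
Proof. by rewrite graph_mxM; kernel_eq; bool_eq. Qed.

Lemma mx_gw : mx_g * mx_w = mx_g.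
Proof. by rewrite mx_Mgraph; [kernel_eq; bool_eq | exact: swap_wK]. Qed.

(** The joined strands of the two factors close into a free loop, which contributes the factor
    [N]. *)
Lemma mx_ee : mx_e * mx_e = mx_e *+ N.
Proof.
rewrite mx_eM -scaler_nat kermatZ; kernel_eq.
under eq_bigr do rewrite eqxx /=.
rewrite sum_const; case: eqP => _; rewrite /= ?mul1r ?mul0r ?mulr0 //.
Qed.

Lemma mx_ff : mx_f * mx_f = mx_f *+ N.
Proof.
rewrite mx_fM -scaler_nat kermatZ; kernel_eq.
under eq_bigr do rewrite eqxx /=.
rewrite sum_const; case: eqP => _; rewrite /= ?mul1r ?mul0r ?mulr0 //.
Qed.

Ltac sum_unique c :=
  rewrite (@sum_bool_unique _ _ c) => [| ? /and4P[/eqP? /eqP? /eqP? /eqP?]]; last by subst.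
Ltac mul_bool_eq := rewrite -natrM mulnb; congr (_%:R); congr nat_of_bool;
  apply/idP/idP; [move=> /andP[/eqP? /and4P[/eqP? /eqP? /eqP? /eqP?]]
                 | move=> /and4P[/eqP? /eqP? /eqP? /eqP?]]; subst; rewrite ?eqxx.

Lemma mx_ef : mx_e * mx_f = mx_g.
Proof.
rewrite mx_eM; apply: eq_kermat => -[[? ?] [? ?]] [[? c] [? ?]].
by rewrite /ker_f /ker_g /=; sum_unique c; mul_bool_eq.
Qed.

Lemma mx_fe : mx_f * mx_e = mx_g.
Proof.
rewrite mx_fM; apply: eq_kermat => -[[? ?] [? ?]] [[c ?] [? ?]].
by rewrite /ker_e /ker_g /=; sum_unique c; mul_bool_eq.
Qed.

(** The swap connects the would-be loop to a through strand, so its colour is determined and no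
    factor [N] arises; likewise in the next three products. *)
Lemma mx_ese : mx_e * mx_s * mx_e = mx_e.
Proof.
rewrite -mulrA graph_mxM mx_eM; apply: eq_kermat => -[[c ?] [? ?]] [[? ?] [? ?]].
by rewrite /ker_e /=; sum_unique c; mul_bool_eq.
Qed.

Lemma mx_ete : mx_e * mx_t * mx_e = mx_e.
Proof.
rewrite -mulrA graph_mxM mx_eM; apply: eq_kermat => -[[? ?] [? c]] [[? ?] [? ?]].
by rewrite /ker_e /=; sum_unique c; mul_bool_eq.
Qed.

Lemma mx_fsf : mx_f * mx_s * mx_f = mx_f.
Proof.
rewrite -mulrA graph_mxM mx_fM; apply: eq_kermat => -[[? ?] [c ?]] [[? ?] [? ?]].
by rewrite /ker_f /=; sum_unique c; mul_bool_eq.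
Qed.

Lemma mx_ftf : mx_f * mx_t * mx_f = mx_f.
Proof.
rewrite -mulrA graph_mxM mx_fM; apply: eq_kermat => -[[? c] [? ?]] [[? ?] [? ?]].
by rewrite /ker_f /=; sum_unique c; mul_bool_eq.
Qed.

Definition cap : M := mx_e + mx_f.
Definition swp : M := mx_s + mx_t.

Lemma mx_sw : mx_s * mx_w = mx_t.
Proof. by rewrite -mx_st mulrA mx_ss mul1r. Qed.

Lemma mx_tt : mx_t * mx_t = 1.
Proof. by rewrite graph_mx_comp graph_mx_id // => -[[? ?] [? ?]]. Qed.

Lemma mx_tw : mx_t * mx_w = mx_s.
Proof. by rewrite -mx_ts mulrA mx_tt mul1r. Qed.

Lemma mx_ws : mx_w * mx_s = mx_t.
Proof. by rewrite -mx_ts -mulrA mx_ss mulr1. Qed.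

Lemma mx_wt : mx_w * mx_t = mx_s.
Proof. by rewrite -mx_st -mulrA mx_tt mulr1. Qed.

Lemma mx_wf : mx_w * mx_f = mx_e * mx_w.
Proof.
have <- : mx_w * mx_f * mx_w = mx_e by rewrite -mulrA -mx_we mulrA mx_ww mul1r.
by rewrite -mulrA mx_ww mulr1.
Qed.

Lemma cap_w : cap * mx_w = mx_w * cap.
Proof. by rewrite mulrDl mulrDr mx_we mx_wf addrC. Qed.

Lemma swp_w : swp * mx_w = swp.
Proof. by rewrite mulrDl mx_sw mx_tw addrC. Qed.

Lemma w_swp : mx_w * swp = swp.
Proof. by rewrite mulrDr mx_ws mx_wt addrC. Qed.

Lemma swp_sqr : swp * swp = (1 + mx_w) *+ 2.
Proof.
rewrite mulrDr !mulrDl mx_ss mx_tt mx_st mx_ts mulr2n.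
by congr (_ + _); rewrite addrC.
Qed.

Lemma cap_sqr : cap * cap = cap *+ N + mx_g *+ 2.
Proof.
rewrite mulrDr !mulrDl mx_ee mx_ff mx_ef mx_fe mulrnDl.
by rewrite mulr2n [mx_g + _]addrC addrACA.
Qed.

Lemma cap_g : cap * mx_g = mx_g *+ (2 * N).
Proof.
have eg : mx_e * mx_g = mx_g *+ N by rewrite -mx_ef mulrA mx_ee mulrnAl.
have fg : mx_f * mx_g = mx_g *+ N by rewrite -mx_fe mulrA mx_ff mulrnAl.
by rewrite mulrDl eg fg -mulrnDr mul2n addnn.
Qed.

Lemma cap_swp_cap : cap * swp * cap = (cap * (1 + mx_w)) *+ 2.
Proof.
(* Mixed products reduce to unmixed ones: one swap is written as the other times [w], and [w] is
   moved past the cup-cap. *)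
have esf : mx_e * mx_s * mx_f = mx_e * mx_w.
  by rewrite -mx_tw -!mulrA mx_wf !mulrA mx_ete.
have etf : mx_e * mx_t * mx_f = mx_e * mx_w.
  by rewrite -mx_sw -!mulrA mx_wf !mulrA mx_ese.
have fse : mx_f * mx_s * mx_e = mx_f * mx_w.
  by rewrite -mx_tw -!mulrA mx_we !mulrA mx_ftf.
have fte : mx_f * mx_t * mx_e = mx_f * mx_w.
  by rewrite -mx_sw -!mulrA mx_we !mulrA mx_fsf.
rewrite /cap /swp !(mulrDl, mulrDr) mx_ese mx_ete mx_fsf mx_ftf esf etf fse fte.
rewrite !mulr1 !mulr2n.
rewrite addrACA [RHS]addrACA [mx_e + _ + _]addrACA [mx_f + _ + _]addrACA.
by congr (_ + _); rewrite addrC.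
Qed.

Lemma cap_swp_g : cap * swp * mx_g = mx_g *+ 4.
Proof.
have es : mx_e * mx_s * mx_g = mx_g by rewrite -mx_ef mulrA mx_ese.
have et : mx_e * mx_t * mx_g = mx_g by rewrite -mx_ef mulrA mx_ete.
have fs : mx_f * mx_s * mx_g = mx_g by rewrite -mx_fe mulrA mx_fsf.
have ft : mx_f * mx_t * mx_g = mx_g by rewrite -mx_fe mulrA mx_ftf.
by rewrite /cap /swp !(mulrDl, mulrDr) es et fs ft -!mulr2n -mulrnA.
Qed.

(** For the trace of a 0-1 kernel, [phi] parametrizes the contributing states by their free colours;
    the trace is [N] to the number of these. *)
Lemma sum_param (J : finType) (phi : J -> state) psi (P : pred state) :
    cancel phi psi -> (forall j, P (phi j)) -> (forall a, P a -> phi (psi a) = a) ->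
  \sum_a (P a)%:R = #|J|%:R :> int.
Proof.
move=> phiK P_phi psiK; rewrite -natr_sum; congr (_%:R).
transitivity #|P|.
  by rewrite -sum1_card [RHS]big_mkcond; apply: eq_bigr => a _; rewrite unfold_in; case: (P a).
rewrite -(card_codom (can_inj phiK)); apply: eq_card => a.
apply/idP/codomP => [/psiK <- | [j ->]]; first by exists (psi a).
exact: P_phi.
Qed.

Ltac tr_param phi psi := rewrite ?kermat_trace (sum_param (phi := phi) (psi := psi));
  [ rewrite ?card_prod ?card_ord ?natrM -?/n; try ring
  | by case=> [] // [] // []
  | by do ?case=> // ? ?; rewrite ?xpair_eqE ?eqxx
  | case=> [[? ?] [? ?]]; rewrite ?xpair_eqE /= => ?; by split_eqs ].

Lemma tr_mx_1 : \tr (1 : M) = n ^+ 4.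
Proof.
rewrite -(graph_mx_id (w := id)) //.
tr_param (fun p : (I * I) * (I * I) => (p.1, p.2))
  (fun a : state => a).
Qed.

Lemma tr_mx_e : \tr (mx_e) = n ^+ 3.
Proof.
tr_param (fun p : I * I * I => ((p.1.1, p.1.2), (p.1.2, p.2)))
  (fun a : state => (a.1.1, a.1.2, a.2.2)).
Qed.

Lemma tr_mx_f : \tr (mx_f) = n ^+ 3.
Proof.
tr_param (fun p : I * I * I => ((p.1.1, p.1.2), (p.2, p.1.1)))
  (fun a : state => (a.1.1, a.1.2, a.2.1)).
Qed.

Lemma tr_mx_s : \tr (mx_s) = n ^+ 3.
Proof.
tr_param (fun p : I * I * I => ((p.1.1, p.1.2), (p.1.1, p.2)))
  (fun a : state => (a.1.1, a.1.2, a.2.2)).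
Qed.

Lemma tr_mx_t : \tr (mx_t) = n ^+ 3.
Proof.
tr_param (fun p : I * I * I => ((p.1.1, p.1.2), (p.2, p.1.2)))
  (fun a : state => (a.1.1, a.1.2, a.2.1)).
Qed.

Lemma tr_mx_w : \tr (mx_w) = n ^+ 2.
Proof.
tr_param (fun p : I * I => (p, p))
  (fun a : state => a.1).
Qed.

Lemma tr_mx_g : \tr (mx_g) = n ^+ 2.
Proof.
tr_param (fun p : I * I => ((p.1, p.2), (p.2, p.1)))
  (fun a : state => a.1).
Qed.

Lemma tr_mx_se : \tr (mx_s * mx_e) = n ^+ 2.
Proof.
rewrite graph_mxM; tr_param (fun p : I * I => ((p.1, p.1), (p.1, p.2)))
  (fun a : state => a.2).
Qed.

Lemma tr_mx_sf : \tr (mx_s * mx_f) = n ^+ 2.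
Proof.
rewrite graph_mxM; tr_param (fun p : I * I => ((p.1, p.2), (p.1, p.1)))
  (fun a : state => a.1).
Qed.

Lemma tr_mx_te : \tr (mx_t * mx_e) = n ^+ 2.
Proof.
rewrite graph_mxM; tr_param (fun p : I * I => ((p.1, p.2), (p.2, p.2)))
  (fun a : state => a.1).
Qed.

Lemma tr_mx_tf : \tr (mx_t * mx_f) = n ^+ 2.
Proof.
rewrite graph_mxM; tr_param (fun p : I * I => ((p.1, p.1), (p.2, p.1)))
  (fun a : state => (a.1.1, a.2.1)).
Qed.

Lemma tr_mx_we : \tr (mx_w * mx_e) = n ^+ 1.
Proof.
rewrite graph_mxM; tr_param (fun p : I => ((p, p), (p, p)))
  (fun a : state => a.1.1).
Qed.

Lemma tr_mx_sg : \tr (mx_s * mx_g) = n ^+ 1.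
Proof.
rewrite graph_mxM; tr_param (fun p : I => ((p, p), (p, p)))
  (fun a : state => a.1.1).
Qed.

Lemma tr_mx_tg : \tr (mx_t * mx_g) = n ^+ 1.
Proof.
rewrite graph_mxM; tr_param (fun p : I => ((p, p), (p, p)))
  (fun a : state => a.1.1).
Qed.

Definition rung_ker a b : int :=
  ker_e a b + ker_f a b + ((b == swap_s a)%:R + (b == swap_t a)%:R).

Lemma rung_kerE : kermat rung_ker = cap + swp.
Proof. by rewrite /cap /swp !kermatD. Qed.

Lemma tr_mulC (X Y : M) : \tr (X * Y) = \tr (Y * X).
Proof. exact: mxtrace_mulC. Qed.

Lemma tr_mx_cap : \tr cap = 2 * n ^+ 3.
Proof. by rewrite raddfD /= tr_mx_e tr_mx_f; ring. Qed.

Lemma tr_mx_capw : \tr (cap * mx_w) = 2 * n.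
Proof.
rewrite cap_w mulrDr raddfD /= mx_wf [X in _ + X]tr_mulC tr_mx_we; ring.
Qed.

Lemma tr_mx_swp : \tr swp = 2 * n ^+ 3.
Proof. by rewrite raddfD /= tr_mx_s tr_mx_t; ring. Qed.

Lemma tr_mx_swpcap : \tr (swp * cap) = 4 * n ^+ 2.
Proof.
rewrite mulrDl (mulrDr mx_s) (mulrDr mx_t) !raddfD /=.
by rewrite tr_mx_se tr_mx_sf tr_mx_te tr_mx_tf; ring.
Qed.

Lemma tr_mx_swpg : \tr (swp * mx_g) = 2 * n.
Proof. by rewrite mulrDl raddfD /= tr_mx_sg tr_mx_tg; ring. Qed.

Let trM : {additive M -> int} := @mxtrace int #|{: state}|.

Lemma tr_rung_pow k : 2 * \tr (kermat rung_ker ^+ k.+1) =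
  2 * lucas (2 * n) k.+1 + 2 * (n ^+ 2 - 1) * lucas n k.+1 + pm2_part n k.+1
  + 2 * (n ^+ 2 - 1) * n ^+ k.+1.
Proof.
exact: (tr_rungE mx_ww cap_w swp_w w_swp mx_wg mx_gw swp_sqr cap_sqr cap_swp_cap
  cap_g cap_swp_g (tau := trM) tr_mulC rung_kerE tr_mx_1 tr_mx_w tr_mx_g tr_mx_cap
  tr_mx_capw tr_mx_swp tr_mx_swpcap tr_mx_swpg).
Qed.

Lemma tr_twisted_rung_pow k : 2 * \tr (mx_w * kermat rung_ker ^+ k.+1) =
  2 * lucas (2 * n) k.+1 + 2 * (n ^+ 2 - 1) * lucas n k.+1 + pm2_part n k.+1
  - 2 * (n ^+ 2 - 1) * n ^+ k.+1.
Proof.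
exact: (tr_rung_wE mx_ww cap_w swp_w w_swp mx_wg mx_gw swp_sqr cap_sqr cap_swp_cap
  cap_g cap_swp_g (tau := trM) tr_mulC rung_kerE tr_mx_1 tr_mx_w tr_mx_g tr_mx_cap
  tr_mx_capw tr_mx_swp tr_mx_swpcap tr_mx_swpg).
Qed.

End Ladder.

(** * Face sums of the ladders *)

Section RungSum.
Variable N : nat.
Local Notation I := 'I_N.
Implicit Types a b : state N.

(* The two rotations at a vertex whose edges, oriented to the right, carry the
   colours (x, x') on the left and (y, y') on the right, and whose rung carries
   p on the side of the vertex and p' on the other side. *)
Definition vertex_sum (x x' y y' p p' : I) : nat :=
  [&& y == x, p == y' & x' == p'] + [&& p == x, x' == y' & y == p'].

(** The second track sees the rung from its other end, hence the exchanged arguments. *)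
Definition rung_prod a b (q : I * I) : nat :=
  (vertex_sum a.1.1 a.1.2 b.1.1 b.1.2 q.1 q.2 *
   vertex_sum a.2.1 a.2.2 b.2.1 b.2.2 q.2 q.1)%N.

Ltac sum_pair c := rewrite (sum_bool_unique (c := c)) /=;
  [ congr (_%:R); congr nat_of_bool; apply/idP/idP => ?; split_eqs
  | case=> ? ? /= ?; split_eqs ].

Lemma sum_rung a b : \sum_q (rung_prod a b q)%:R = rung_ker a b :> int.
Proof.
case: a => [[x x'] [z z']]; case: b => [[y y'] [u u']]; rewrite /rung_prod /=.
(* The four pairs of rotations, in the order giving e, f, s, t; in each summand the rung colours [q]
   are forced by the outer ones. *)
transitivity (\sum_(q : I * I)
  ([&& y == x, q.1 == y', x' == q.2, q.2 == z, z' == u' & u == q.1]%:R +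
   [&& q.1 == x, x' == y', y == q.2, u == z, q.2 == u' & z' == q.1]%:R +
   ([&& q.1 == x, x' == y', y == q.2, q.2 == z, z' == u' & u == q.1]%:R +
    [&& y == x, q.1 == y', x' == q.2, u == z, q.2 == u' & z' == q.1]%:R)) : int).
  by apply: eq_bigr => q _; rewrite /vertex_sum mulnDl !mulnDr !mulnb !natrD -!andbA; ring.
rewrite !big_split /= /rung_ker /ker_e /ker_f /swap_s /swap_t /= !xpair_eqE /=.
congr (_ + _ + (_ + _)).
- by sum_pair (y', x').
- by sum_pair (x, y).
- by sum_pair (x, y).
- by sum_pair (y', x').
Qed.

End RungSum.

Section Gluing.
Variables (N n : nat) (omega : state N -> state N).
Local Notation I := 'I_N.

(** Only the seam between the last section and the first is twisted: [omega] is the identity for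
    circular ladders and the exchange of tracks for Moebius ladders. *)
Definition prev_state (y : {ffun 'I_n.+1 -> state N}) (l : 'I_n.+1) : state N :=
  if l == ord0 then omega (y (ord_pred l)) else y (ord_pred l).

Lemma sum_rung_cycle :
  \sum_(y : {ffun 'I_n.+1 -> state N}) \sum_(q : {ffun 'I_n.+1 -> I * I})
    \prod_l (rung_prod (prev_state y l) (y l) (q l))%:R =
  \tr (graph_mx omega * kermat (@rung_ker N) ^+ n.+1) :> int.
Proof.
rewrite -[RHS]sum_cycles; apply: eq_bigr => y _.
rewrite -(bigA_distr_bigA (fun l q => (rung_prod (prev_state y l) (y l) q)%:R)) /=.
under eq_bigr => l _ do rewrite sum_rung.
rewrite big_ord_recl {1}/prev_state eqxx; congr (rung_ker (omega (y _)) _ * _).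
  by apply: val_inj => /=; rewrite modn_small.
apply: eq_bigr => l _; congr (rung_ker _ _); rewrite /prev_state.
case: eqP => [/(congr1 val)//|_]; congr (y _); apply: val_inj => /=.
by rewrite modnDr modn_small ?add0n // ltnS ltnW.
Qed.

End Gluing.

Lemma forall_ord3 (P : pred nat) : [forall k : 'I_3, P k] = [&& P 0%N, P 1%N & P 2%N].
Proof.
apply/forallP/and3P => [P_all | [P0 P1 P2] [[|[|[|k]]] lt_k] //].
by split; [apply: (P_all (@Ordinal 3 0 isT)) | apply: (P_all (@Ordinal 3 1 isT))
          | apply: (P_all (@Ordinal 3 2 isT))].
Qed.

(** The colours are functions on [nat], so that the indices modulo 3 reduce by computation. *)
Lemma sum_turns (C : eqType) (gamma delta : nat -> C) :
  (\sum_(b : bool) [forall k : 'I_3, gamma (turn b k) == delta k])%N =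
  ([&& gamma 1 == delta 0, gamma 2 == delta 1 & gamma 0 == delta 2]%N +
   [&& gamma 2 == delta 0, gamma 0 == delta 1 & gamma 1 == delta 2])%N.
Proof.
rewrite big_bool; congr (_ + _)%N; congr nat_of_bool.
  exact: (forall_ord3 (fun k => gamma (k.+1 %% 3)%N == delta k)).
exact: (forall_ord3 (fun k => gamma ((k + 3).-1 %% 3)%N == delta k)).
Qed.

Definition track (N : nat) (second head : bool) (a : state N) : 'I_N :=
  let p := if second then a.2 else a.1 in if head then p.2 else p.1.

Lemma prod_bool_pair (J : finType) (f : bool * J -> nat) :
  (\prod_v f v = \prod_l (f (false, l) * f (true, l)))%N.
Proof.
transitivity (\prod_b \prod_l f (b, l))%N.
  by rewrite pair_bigA; apply: eq_bigr => -[].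
rewrite big_bool big_split; exact: mulnC.
Qed.

Section CircularLadder.
Variables (N n : nat).
Local Notation I := 'I_N.
Let G := CL n.+1.

(** Labels 0, 1, 2 are the half-edges to the left, to the right and on the rung; the left one is the
    far end of the preceding edge. *)
Definition CL_flag (b : bool) (l : 'I_n.+1) (k : nat) : dart G :=
  match k with
  | 0 => (inl (b, ord_pred l), true)
  | 1 => (inl (b, l), false)
  | _ => (inr l, b)
  end.

Definition CL_dart (x : vert G * 'I_3) : dart G := CL_flag x.1.1 x.1.2 x.2.

Lemma CL_dart_bij : bijective CL_dart.
Proof.
exists (fun d : dart G => match d with
  | (inl (b, l), true) => ((b, ordS l), inord 0)
  | (inl (b, l), false) => ((b, l), inord 1)
  | (inr l, b) => ((b, l), inord 2)
  end).
  case=> [[b l] [[|[|[|k]]] lt_k]] //=; rewrite ?ord_predK; congr (_, _);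
  by apply: val_inj; rewrite /= inordK.
by case=> [[[b l]|l] []]; rewrite /CL_dart /CL_flag /= inordK // ?ordSK.
Qed.

Lemma CL_dart_origin v k : origin (CL_dart (v, k)) = v.
Proof.
by case: v k => b l [[|[|[|k]]] lt_k]; rewrite /origin /CL_dart /CL_flag //= ?ord_predK; case: b.
Qed.

Definition CL_coloring (yq : {ffun 'I_n.+1 -> state N} * {ffun 'I_n.+1 -> I * I}) :
    {ffun dart G -> I} :=
  [ffun d => match d with
    | (inl (b, l), head) => track b head (yq.1 l)
    | (inr l, b) => if b then (yq.2 l).2 else (yq.2 l).1
    end].

Lemma CL_coloring_bij : bijective CL_coloring.
Proof.
exists (fun c : {ffun dart G -> I} =>
  ([ffun l => ((c (inl (false, l), false), c (inl (false, l), true)),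
               (c (inl (true, l), false), c (inl (true, l), true)))],
   [ffun l => (c (inr l, false), c (inr l, true))])).
  case=> y q; congr (_, _); apply/ffunP=> l; rewrite !ffunE /track /=.
    by case: (y l) => [[? ?] [? ?]].
  by case: (q l).
by move=> c; apply/ffunP=> -[[[[] l]|l] []]; rewrite !ffunE /track /= ?ffunE.
Qed.

Lemma CL_face_sum :
  (\sum_(s : {perm dart G} | is_rotation s) N ^ #|faces s|)%:R =
  \tr (kermat (@rung_ker N) ^+ n.+1) :> int.
Proof.
rewrite -[kermat _ ^+ _]mul1r -(@graph_mx_id N id) // -sum_rung_cycle.
rewrite (sum_rotations CL_dart_bij CL_dart_origin) natr_sum pair_bigA /=.
rewrite (reindex CL_coloring) /=; last exact/onW_bij/CL_coloring_bij.
apply: eq_bigr => -[y q] _ /=; rewrite natr_prod.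
rewrite -!natr_prod prod_bool_pair; congr (_%:R); apply: eq_bigr => l _.
have prevE : prev_state id y l = y (ord_pred l) by rewrite /prev_state; case: ifP.
by congr (_ * _)%N; rewrite (sum_turns (fun k => CL_coloring (y, q) (CL_flag _ l k))
  (fun k => CL_coloring (y, q) (flip (CL_flag _ l k)))) !ffunE /= prevE.
Qed.

End CircularLadder.

Section MobiusLadder.
Variables (N n : nat).
Local Notation I := 'I_N.
Let G := ML n.+1.

Definition ML_flag (v : 'I_(n.+1 + n.+1)) (k : nat) : dart G :=
  match k with
  | 0 => (inl (ord_pred v), true)
  | 1 => (inl v, false)
  | _ => match split v with inl l => (inr l, false) | inr l => (inr l, true) end
  end.

Definition ML_dart (x : vert G * 'I_3) : dart G := ML_flag x.1 x.2.

Lemma ML_dart_bij : bijective ML_dart.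
Proof.
exists (fun d : dart G => match d with
  | (inl v, true) => (ordS v, inord 0)
  | (inl v, false) => (v, inord 1)
  | (inr l, b) => (if b then rshift n.+1 l else lshift n.+1 l, inord 2)
  end).
  case=> v [[|[|[|k]]] lt_k] //=; rewrite /ML_dart /ML_flag /= ?ord_predK; try congr (_, _);
  try by apply: val_inj; rewrite /= inordK.
  by case: (split_ordP v) => l ->; congr (_, _); apply: val_inj; rewrite /= inordK.
case=> [[v|l] []]; rewrite /ML_dart /ML_flag /= inordK // ?ordSK //=.
  by case: split_ordP => l' /eqP; rewrite ?eq_rlshift ?eq_rshift // => /eqP->.
by case: split_ordP => l' /eqP; rewrite ?eq_lrshift ?eq_lshift // => /eqP->.
Qed.

Lemma ML_dart_origin v k : origin (ML_dart (v, k)) = v.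
Proof.
case: k => [[|[|[|k]]] lt_k]; rewrite /origin /ML_dart /ML_flag //= ?ord_predK //.
by case: split_ordP.
Qed.

Definition ML_coloring (yq : {ffun 'I_n.+1 -> state N} * {ffun 'I_n.+1 -> I * I}) :
    {ffun dart G -> I} :=
  [ffun d => match d with
    | (inl v, head) => match split v with
       | inl l => track false head (yq.1 l)
       | inr l => track true head (yq.1 l)
       end
    | (inr l, b) => if b then (yq.2 l).2 else (yq.2 l).1
    end].

Lemma ML_coloring_bij : bijective ML_coloring.
Proof.
exists (fun c : {ffun dart G -> I} =>
  ([ffun l => ((c (inl (lshift _ l), false), c (inl (lshift _ l), true)),
               (c (inl (rshift _ l), false), c (inl (rshift _ l), true)))],
   [ffun l => (c (inr l, false), c (inr l, true))])).
  case=> y q; congr (_, _); apply/ffunP=> l; rewrite !ffunE /track /=.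
    rewrite (unsplitK (inl l)) (unsplitK (inr l)).
    by case: (y l) => [[? ?] [? ?]].
  by case: (q l).
move=> c; apply/ffunP=> -[[v|l] []]; rewrite !ffunE /track /= ?ffunE //.
  by case: split_ordP => l ->; rewrite ffunE.
by case: split_ordP => l ->; rewrite ffunE.
Qed.

Let vtx (b : bool) (l : 'I_n.+1) := if b then rshift n.+1 l else lshift n.+1 l.

Lemma val_ord_pred m (i : 'I_m) : ord_pred i = (if i == 0 :> nat then m.-1 else i.-1)%N :> nat.
Proof.
case: i => -[|k] lt_km /=; first by rewrite modn_small // prednK.
by rewrite modnDr modn_small // ltnW.
Qed.

Lemma split_vtx b l : split (vtx b l) = if b then inr l else inl l.
Proof. by case: b; [apply: (unsplitK (inr l)) | apply: (unsplitK (inl l))]. Qed.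

(** Stepping back from the first vertex of one half of the long cycle leads to the last vertex of
    the other half: this is where the twist [swap_w] comes from. *)
Lemma ord_pred_vtx b l :
  ord_pred (vtx b l) = vtx (if l == ord0 then ~~ b else b) (ord_pred l).
Proof.
apply: ord_inj; rewrite val_ord_pred.
have -> : (l == ord0) = (l == 0 :> nat)%N by [].
have := val_ord_pred l; move: (ord_pred l) => p.
have [l0 | l_neq0] := eqVneq (l : nat) 0%N; case: b => /= def_p; rewrite ?l0; try lia.
all: by case: eqP; lia.
Qed.

Lemma ML_coloring_edge b l head y q :
  ML_coloring (y, q) (inl (vtx b l), head) = track b head (y l).
Proof. by rewrite ffunE /= split_vtx; case: b. Qed.

Lemma ML_coloring_prev b l head y q :
  ML_coloring (y, q) (inl (ord_pred (vtx b l)), head) =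
  track b head (prev_state (@swap_w N) y l).
Proof.
rewrite ord_pred_vtx ML_coloring_edge /prev_state.
by case: ifP => // _; rewrite /track /swap_w; case: b.
Qed.

Lemma ML_vertex_sum b l y q :
  (\sum_(t : bool) [forall k,
     ML_coloring (y, q) (ML_dart (vtx b l, turn t k)) ==
     ML_coloring (y, q) (flip (ML_dart (vtx b l, k)))])%N =
  (let a := prev_state (@swap_w N) y l in
   vertex_sum (track b false a) (track b true a) (track b false (y l))
     (track b true (y l)) (if b then (q l).2 else (q l).1)
     (if b then (q l).1 else (q l).2)).
Proof.
rewrite (sum_turns (fun k => ML_coloring (y, q) (ML_flag _ k))
  (fun k => ML_coloring (y, q) (flip (ML_flag _ k)))).
rewrite /ML_flag /flip /= !ML_coloring_edge !ML_coloring_prev split_vtx.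
by case: b => /=; rewrite !ffunE.
Qed.

Lemma ML_face_sum :
  (\sum_(s : {perm dart G} | is_rotation s) N ^ #|faces s|)%:R =
  \tr (mx_w N * kermat (@rung_ker N) ^+ n.+1) :> int.
Proof.
rewrite -sum_rung_cycle.
rewrite (sum_rotations ML_dart_bij ML_dart_origin) natr_sum pair_bigA /=.
rewrite (reindex ML_coloring) /=; last exact/onW_bij/ML_coloring_bij.
apply: eq_bigr => -[y q] _ /=; rewrite -!natr_prod big_split_ord /= -big_split /=.
congr (_%:R); apply: eq_bigr => l _.
by rewrite (ML_vertex_sum false) (ML_vertex_sum true).
Qed.

End MobiusLadder.

(** * Coefficients of the face sums *)

(* The number n / (n - j) * 'C(n - j, j), with value 2 at n = j = 0. *)
Fixpoint lucas_coef (n j : nat) : nat :=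
  match n, j with
  | 0, 0 => 2
  | 0, _.+1 => 0
  | 1, 0 => 1
  | 1, _.+1 => 0
  | _.+1, 0 => 1
  | (n2.+1 as n1).+1, j1.+1 => lucas_coef n1 j + lucas_coef n2 j1
  end.

Lemma lucas_coefS n j : lucas_coef n.+2 j.+1 = (lucas_coef n.+1 j.+1 + lucas_coef n j)%N.
Proof. by []. Qed.

Lemma lucas_coef0 n : lucas_coef n.+1 0 = 1%N.
Proof. by case: n. Qed.

Lemma lucas_coef_small n j : (n < j.*2)%N -> lucas_coef n j = 0%N.
Proof.
suff: forall j, ((n < j.*2)%N -> lucas_coef n j = 0%N) /\
                ((n.+1 < j.*2)%N -> lucas_coef n.+1 j = 0%N).
  by move=> /(_ j) [].
elim: n {j} => [|n IHn] j; first by case: j => [|[|j]].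
split=> [|lt_nj]; first by case: (IHn j).
case: j lt_nj => // j lt_nj; rewrite lucas_coefS (IHn j.+1).2 1?(IHn j).1 //; lia.
Qed.

Lemma coef_lucas_big (c : int) n k : (n < k)%N -> (lucas (c *: 'X) n)`_k = 0.
Proof.
suff: forall k, ((n < k)%N -> (lucas (c *: 'X) n)`_k = 0) /\
                ((n.+1 < k)%N -> (lucas (c *: 'X) n.+1)`_k = 0).
  by move=> /(_ k) [].
elim: n {k} => [|n IHn] k.
  split; first by case: k => // k _; rewrite /= -[2]/(2%:R) -polyC_natr coefC.
  by case: k => [|[|k]] // _; rewrite /= coefZ coefX mulr0.
split; first by case: (IHn k).
case: k => // k lt_nk; rewrite lucasSS -scalerAl coefD coefZ coefXM /=.
rewrite (IHn k).2 // mulr0 add0r -[8]/(8%:R) mulr_natl coefMn (IHn k.+1).1 ?mul0rn //; lia.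
Qed.

(** In the recurrence one index is spent on a factor [c X], or two indices on a factor 8; [j] counts
    the factors 8. *)
Lemma coef_lucas (c : int) n k j : (k + j.*2 = n)%N ->
  (lucas (c *: 'X) n)`_k = c ^+ k * 8 ^+ j * (lucas_coef n j)%:R.
Proof.
suff: forall k j, ((k + j.*2 = n)%N ->
    (lucas (c *: 'X) n)`_k = c ^+ k * 8 ^+ j * (lucas_coef n j)%:R) /\
  ((k + j.*2 = n.+1)%N ->
    (lucas (c *: 'X) n.+1)`_k = c ^+ k * 8 ^+ j * (lucas_coef n.+1 j)%:R).
  by move=> /(_ k j) [].
elim: n {k j} => [|n IHn] k j.
  split; case: k j => [|[|k]] [|[|j]] //= _.
    by rewrite -[2]/(2%:R) -polyC_natr coefC.
  by rewrite coefZ coefX /=; ring.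
split; first by case: (IHn k j).
move=> def_n; rewrite lucasSS -scalerAl coefD coefZ coefXM.
rewrite -[8 * _]/(8%:R * _) mulr_natl coefMn -(mulr_natl (_)`_k).
case: k def_n => [|k] def_n.
  case: j def_n => [|j] def_n; first by lia.
  rewrite eqxx mulr0 add0r (IHn 0%N j).1; last by lia.
  by rewrite lucas_coefS (@lucas_coef_small n.+1) ?add0n ?(exprS 8); [ring | lia].
have -> : (if k.+1 == 0%N then 0 else (lucas (c *: 'X) n.+1)`_k.+1.-1) =
  (lucas (c *: 'X) n.+1)`_k by [].
rewrite (IHn k j).2; last by lia.
case: j def_n => [|j] def_n.
  rewrite !lucas_coef0 coef_lucas_big; last by lia.
  by rewrite (exprS c); ring.
rewrite (IHn k.+1 j).1; last by lia.
by rewrite lucas_coefS natrD (exprS c) (exprS 8); ring.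
Qed.

Lemma coef_pm2_part n k : (pm2_part ('X : {poly int}) n)`_k =
  if odd n then (k == 3%N)%:R * 2 ^+ n.+1
  else ((k == 4%N)%:R - 3 * (k == 2%N)%:R) * 2 ^+ n.
Proof.
suff: forall k, (pm2_part ('X : {poly int}) n)`_k =
    (if odd n then (k == 3%N)%:R * 2 ^+ n.+1
     else ((k == 4%N)%:R - 3 * (k == 2%N)%:R) * 2 ^+ n) /\
  (pm2_part ('X : {poly int}) n.+1)`_k =
    (if odd n.+1 then (k == 3%N)%:R * 2 ^+ n.+2
     else ((k == 4%N)%:R - 3 * (k == 2%N)%:R) * 2 ^+ n.+1).
  by move=> /(_ k) [].
elim: n {k} => [|n IHn] k.
  rewrite /= coefB coefXn -[3 * _]/(3%:R * _) -[4 * _]/(4%:R * _).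
  by rewrite !mulr_natl !coefMn !coefXn; split; ring.
split; first by case: (IHn k).
rewrite pm2_partSS -[4 * _]/(4%:R * _) mulr_natl coefMn (IHn k).1 -mulr_natl /= negbK.
by case: ifP => _; rewrite !exprS; ring.
Qed.

Definition genus_poly (sg : int) n : {poly int} :=
  (lucas (2 *: 'X) n + ('X^2 - 1) * lucas (1 *: 'X) n + sg *: (('X^2 - 1) * 'X^n)) *+ 2
  + pm2_part 'X n.

(** Half the coefficient of [X^(n + 2 - 2 i)] in [pm2_part], whose only powers are the fourth and
    second for even [n] and the third for odd [n]. *)
Definition pm2_coef n i : int :=
  if i.*2.+2 == n then 2 ^+ n.-1 else if i.*2 == n then - 3 * 2 ^+ n.-1
  else if i.*2.+1 == n then 2 ^+ n else 0.

(* The sign [sg] is 1 for the circular and -1 for the Moebius ladder. *)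
Definition genus_coef (sg : int) n i : int :=
  8 ^+ i * (lucas_coef n i)%:R
  + (if i is j.+1 then (2 ^+ (n + j) - 8 ^+ j) * (lucas_coef n j)%:R else 0)
  + sg * ((i == 0)%:R - (i == 1)%:R)
  + pm2_coef n i.

(** [k + 2 i = n + 2] is Euler's formula for [2 n] vertices, [3 n] edges and [k] faces. *)
Lemma coef_genus_poly sg n k i : (0 < n)%N -> (k + i.*2 = n.+2)%N ->
  (genus_poly sg n)`_k = 2 * genus_coef sg n i.
Proof.
move=> n_gt0 def_n; rewrite coefD coefMn coef_pm2_part.
have -> : (if odd n then (k == 3%N)%:R * 2 ^+ n.+1
     else ((k == 4%N)%:R - 3 * (k == 2%N)%:R) * 2 ^+ n) =
  2 * pm2_coef n i.
  rewrite /pm2_coef.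
  have n_expr : 2 ^+ n = 2 * 2 ^+ n.-1 :> int by rewrite -exprS prednK.
  rewrite exprS; case odd_n: (odd n).
    have -> : (i.*2.+2 == n) = false by lia.
    have -> : (i.*2 == n) = false by lia.
    have -> : (k == 3%N) = (i.*2.+1 == n) by lia.
    by case: (_ == n); rewrite /=; ring.
  have -> : (k == 4%N) = (i.*2.+2 == n) by lia.
  have -> : (k == 2%N) = (i.*2 == n) by lia.
  have -> : (i.*2.+1 == n) = false by lia.
  case: (eqVneq i.*2.+2 n) => def_i; last first.
    by case: (_ == n); rewrite ?n_expr /=; ring.
  have -> : (i.*2 == n) = false by lia.
  by rewrite n_expr /=; ring.
rewrite !coefD coefZ !mulrBl !mul1r !coefB.
rewrite !coefXnM !coefXn.
have -> : (lucas (2 *: 'X) n)`_k =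
    if i is j.+1 then 2 ^+ (n + j) * (lucas_coef n j)%:R else 0 :> int.
  case: i def_n => [|j] def_n; first by rewrite coef_lucas_big //; lia.
  rewrite (@coef_lucas _ _ _ j); last by lia.
  (* Here [k + 2 j = n], so [2^k 8^j = 2^(n + j)]. *)
  rewrite (_ : 8 = 2 ^+ 3) // -exprM -exprD; congr (_ ^+ _ * _); lia.
have -> : (if (k < 2)%N then 0 else (lucas (1 *: 'X) n)`_(k - 2)) =
    8 ^+ i * (lucas_coef n i)%:R :> int.
  case: ltnP => [k_small | k_big]; first by rewrite lucas_coef_small ?mulr0; lia.
  by rewrite (@coef_lucas _ _ _ i) ?expr1n ?mul1r; lia.
have -> : (lucas (1 *: 'X) n)`_k = if i is j.+1 then 8 ^+ j * (lucas_coef n j)%:R else 0 :> int.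
  case: i def_n => [|j] def_n; first by rewrite coef_lucas_big //; lia.
  by rewrite (@coef_lucas _ _ _ j) ?expr1n ?mul1r; lia.
have -> : (if (k < 2)%N then 0 else ((k - 2)%N == n)%:R) = (i == 0%N)%:R :> int.
  case: ltnP => k_small; last by congr ((nat_of_bool _)%:R); lia.
  by case: eqP; lia.
have -> : (k == n) = (i == 1%N) by lia.
rewrite /genus_coef -mulr_natl.
by case: (i) => [|j]; ring.
Qed.

Lemma poly_nat_eq0 (p : {poly int}) : (forall N : nat, p.[N%:R] = 0) -> p = 0.
Proof.
move=> p0; apply/eqP/negPn/negP => nz_p.
pose s := [seq (N%:R : int) | N <- iota 0 (size p)].
have: (size s < size p)%N.
  apply: max_poly_roots => //; first by apply/allP=> _ /mapP[N _ ->]; apply/rootP/p0.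
  by rewrite map_inj_uniq ?iota_uniq // => m1 m2 /eqP; rewrite eqr_nat => /eqP.
by rewrite size_map size_iota ltnn.
Qed.

(** The face sums at all [N] determine the generating polynomial [R] of the face numbers, and the
    genus counts are its coefficients. *)
Lemma genus_count_coef (G : mgraph) (sg : int) n : (0 < n)%N ->
    #|vert G| = n.*2 -> #|edge G| = (n.*2 + n)%N ->
    (forall N, 2 * (\sum_(s : {perm dart G} | is_rotation s) N ^ #|faces s|)%:R =
       (genus_poly sg n).[N%:R]) ->
  forall i, (genus_count G i)%:R = genus_coef sg n i.
Proof.
move=> n_gt0 cardV cardE face_sum i.
pose R : {poly int} := \sum_(s : {perm dart G} | is_rotation s) 'X^#|faces s|.
have R_E : R *+ 2 = genus_poly sg n.
  apply/eqP; rewrite -subr_eq0; apply/eqP/poly_nat_eq0 => N.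
  rewrite hornerD hornerN hornerMn -face_sum natr_sum horner_sum -mulr_natl.
  by apply/eqP; rewrite subr_eq0; apply/eqP; congr (_ * _); apply: eq_bigr => s _;
     rewrite hornerXn natrX.
have count_E k : (k + i.*2 = n.+2)%N -> (genus_count G i)%:R = R`_k.
  move=> def_n; rewrite coef_sum /genus_count -sum1_card natr_sum /=.
  rewrite [LHS]big_mkcond [RHS]big_mkcond; apply: eq_bigr => s _; rewrite inE /=.
  case: (is_rotation s) => //=; rewrite coefXn /has_genus cardV cardE.
  have -> : (n.*2 + #|faces s| + 2 * i == n.*2 + n + 2)%N = (k == #|faces s|) by lia.
  by case: eqP.
have [le_in | lt_ni] := leqP i.*2 n.+2.
  have def_n : (n.+2 - i.*2 + i.*2 = n.+2)%N by lia.
  apply: (@mulfI _ 2) => //.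
  by rewrite -(coef_genus_poly sg n_gt0 def_n) -R_E coefMn (count_E _ def_n) mulr_natl.
(* Beyond [2 i = n + 2] Euler's formula would need a negative number of faces, and every term of
   [genus_coef] vanishes. *)
have -> : genus_count G i = 0%N.
  apply/eqP; rewrite /genus_count cards_eq0; apply/eqP/setP=> s; rewrite !inE.
  by apply/negbTE; rewrite negb_and /has_genus cardV cardE; apply/orP; right; lia.
rewrite /genus_coef /pm2_coef lucas_coef_small; last by lia.
have -> : (i == 0%N) = false by lia.
have -> : (i == 1%N) = false by lia.
have -> : (i.*2.+2 == n) = false by lia.
have -> : (i.*2 == n) = false by lia.
have -> : (i.*2.+1 == n) = false by lia.
by case: i lt_ni {count_E} => [|j] lt_ni; rewrite ?(@lucas_coef_small n j) ?mulr0 ?addr0 //; lia.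
Qed.

Lemma horner_lucas (p : {poly int}) n x : (lucas p n).[x] = lucas p.[x] n.
Proof.
suff: (lucas p n).[x] = lucas p.[x] n /\ (lucas p n.+1).[x] = lucas p.[x] n.+1 by case.
elim: n => [|n [IH0 IH1]]; first by rewrite /= -[2]/(2%:R) -polyC_natr hornerC.
split=> //; rewrite !lucasSS hornerD hornerM IH1 -[8 * _]/(8%:R * _) mulr_natl.
by rewrite hornerMn IH0 mulr_natl.
Qed.

Lemma horner_pm2_part n x : (pm2_part ('X : {poly int}) n).[x] = pm2_part x n.
Proof.
suff: (pm2_part ('X : {poly int}) n).[x] = pm2_part x n /\
  (pm2_part ('X : {poly int}) n.+1).[x] = pm2_part x n.+1 by case.
elim: n => [|n [IH0 IH1]].
  rewrite /= -[3 * _]/(3%:R * _) -[4 * _]/(4%:R * _) !mulr_natl hornerD hornerN.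
  by rewrite !hornerMn !hornerXn.
by split=> //; rewrite !pm2_partSS -[4 * _]/(4%:R * _) mulr_natl hornerMn IH0 mulr_natl.
Qed.

Lemma horner_genus_poly sg n x : (genus_poly sg n).[x] =
  2 * lucas (2 * x) n + 2 * (x ^+ 2 - 1) * lucas x n + pm2_part x n
  + sg * (2 * (x ^+ 2 - 1) * x ^+ n).
Proof.
rewrite /genus_poly hornerD hornerMn !(hornerD, hornerM, hornerZ) !horner_lucas horner_pm2_part.
rewrite !(hornerZ, hornerD, hornerN, hornerC, hornerXn, hornerX) mul1r.
by rewrite -mulr_natl; ring.
Qed.

Lemma CL_genus_count n i : (0 < n)%N -> (genus_count (CL n) i)%:R = genus_coef 1 n i.
Proof.
case: n => // n _; apply: genus_count_coef => // [||N].
- by rewrite card_prod card_bool card_ord; lia.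
- by rewrite card_sum card_prod card_bool card_ord; lia.
by rewrite CL_face_sum tr_rung_pow horner_genus_poly mul1r.
Qed.

Lemma ML_genus_count n i : (0 < n)%N -> (genus_count (ML n) i)%:R = genus_coef (-1) n i.
Proof.
case: n => // n _; apply: genus_count_coef => // [||N].
- by rewrite card_ord; lia.
- by rewrite card_sum !card_ord; lia.
by rewrite ML_face_sum tr_twisted_rung_pow horner_genus_poly mulN1r.
Qed.

(** * Unimodality *)

Lemma lucas_coef_gt0 n j : (j.*2 <= n)%N -> (0 < lucas_coef n j)%N.
Proof.
suff: forall j, ((j.*2 <= n)%N -> (0 < lucas_coef n j)%N) /\
                ((j.*2 <= n.+1)%N -> (0 < lucas_coef n.+1 j)%N).
  by move=> /(_ j) [].
elim: n {j} => [|n IHn] j; first by case: j => [|[|j]].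
split=> [|le_jn]; first by case: (IHn j).
case: j le_jn => // j le_jn; rewrite lucas_coefS addn_gt0 (IHn j).1 ?orbT //; lia.
Qed.

(** The closed form [n (n - j - 1)! / (j! (n - 2 j)!)] with denominators cleared. *)
Lemma lucas_coef_fact n m j : (n = m + j.*2)%N -> (0 < n)%N ->
  (j`! * m`! * lucas_coef n j = n * (m + j).-1`!)%N.
Proof.
elim/ltn_ind: n m j => n IHn m [|j] def_n n_gt0.
  case: m def_n n_gt0 => [|m] -> // _.
  by rewrite addn0 lucas_coef0 fact0 mul1n muln1 factS.
have {}def_n : n = (m + j.*2).+2 by lia.
subst n; rewrite lucas_coefS mulnDr.
case: m IHn {n_gt0} => [|m] IHn.
  rewrite lucas_coef_small; last by lia.
  case: j IHn => [|j] // IHn.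
  have := IHn j.+1.*2 _ 0%N j.+1; rewrite !add0n => /(_ _ erefl isT).
  rewrite succnK fact0 !muln1 factS => /(_ ltac:(lia)) IH0.
  by rewrite muln0 !add0n (factS j.+1) (factS j) -mulnA IH0 -!muln2; ring.
have IH1 := IHn (m.+1 + j.*2).+1 _ m j.+1 _ isT.
have IH2 := IHn (m.+1 + j.*2) _ m.+1 j erefl isT.
move: IH1 IH2 => /(_ ltac:(lia) ltac:(lia)) IH1 /(_ ltac:(lia)) IH2.
rewrite addnS /= in IH1; rewrite addSn /= in IH2.
rewrite !addSn addnS /= (factS (m + j)) (factS m) (factS j) in IH1 IH2 *.
set F := (m + j)`! in IH1 IH2 *.
have -> : ((j.+1 * j`!) * (m.+1 * m`!) * lucas_coef (m + j.*2).+2 j.+1 = 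
   m.+1 * (j.+1 * j`! * m`! * lucas_coef (m + j.*2).+2 j.+1))%N by ring.
have -> : ((j.+1 * j`!) * (m.+1 * m`!) * lucas_coef (m + j.*2).+1 j = 
   j.+1 * (j`! * (m.+1 * m`!) * lucas_coef (m + j.*2).+1 j))%N by ring.
rewrite IH1 IH2 -muln2; ring.
Qed.

Lemma lucas_coef_ratio n m j : (n = m.+2 + j.*2)%N ->
  (j.+1 * (m + j).+1 * lucas_coef n j.+1 = m.+2 * m.+1 * lucas_coef n j)%N.
Proof.
move=> def_n; have n_gt0 : (0 < n)%N by lia.
have IH0 := lucas_coef_fact def_n n_gt0.
have /lucas_coef_fact/(_ n_gt0) IH1 : (n = m + j.+1.*2)%N by lia.
rewrite addnS /= in IH1; rewrite !addSn /= !factS in IH0.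
rewrite factS in IH1.
apply/eqP; rewrite -(@eqn_pmul2l (j`! * m`!)) ?muln_gt0 ?fact_gt0 //; apply/eqP.
transitivity (n * ((m + j).+1 * (m + j)`!))%N; last by rewrite -IH0; ring.
transitivity ((m + j).+1 * (n * (m + j)`!))%N; last by ring.
by rewrite -IH1; ring.
Qed.

(** * Inequalities between consecutive Lucas coefficients, for [m = n - 2 j] and [P = 2^m] *)

Section Brackets.
Variables j m P L0 L1 L2 : int.
Hypothesis L0_gt0 : 0 < L0.
Hypothesis ratio : (j + 1) * (m + j - 1) * L1 = m * (m - 1) * L0.

(** The quotient of [L1] by [L0] grows with [m] and reaches one half at [m = j + 1], where the
    leading terms tie. *)
Lemma ratio_le_half : 2 <= m -> m <= j + 1 -> 2 * L1 <= L0.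
Proof.
move=> m_ge2 le_mj.
have: 0 <= ((j + 1) * (m + j - 1) - 2 * (m * (m - 1))) * L0 by apply: mulr_ge0; nia.
have -> : ((j + 1) * (m + j - 1) - 2 * (m * (m - 1))) * L0 =
  (j + 1) * (m + j - 1) * (L0 - 2 * L1).
  by rewrite mulrBl -(mulrA 2) -ratio; ring.
by rewrite pmulr_rge0; [lia | apply: mulr_gt0; lia].
Qed.

(** The main part of the drop in genus coefficients, divided by [8^j], less one [L0] kept in reserve
    against the terms in powers of 2. *)
Lemma bracket_down : 2 <= m -> m <= j -> 2 * L2 <= L1 ->
  10 * (j + 1) < (P + 8) * (1 + j - m) -> 0 <= P ->
  0 < (P - 2) * L0 + (16 - 2 * P) * L1 - 64 * L2.
Proof.
move=> m_ge2 le_mj le_L21 big_P P_ge0.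
(* Obtained by bounding [64 L2] by [32 L1]. *)
suff: 0 < (P + 8) * (L0 - 2 * L1) - 10 * L0 by lia.
have gap : (1 + j - m) * L0 <= (j + 1) * (L0 - 2 * L1).
  have: 0 <= (m * (1 + j - m)) * L0 by apply: mulr_ge0; nia.
  have -> : m * (1 + j - m) * L0 =
    (m + j - 1) * ((j + 1) * (L0 - 2 * L1) - (1 + j - m) * L0).
    transitivity ((j + 1) * (m + j - 1) * L0 - 2 * ((j + 1) * (m + j - 1) * L1)
       - (m + j - 1) * (1 + j - m) * L0); last by ring.
    by rewrite ratio; ring.
  by rewrite pmulr_rge0; lia.
have: 0 <= (P + 8) * ((j + 1) * (L0 - 2 * L1) - (1 + j - m) * L0).
  by apply: mulr_ge0; lia.
have: 0 < ((P + 8) * (1 + j - m) - 10 * (j + 1)) * L0 by apply: mulr_gt0; lia.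
move=> pos1 pos2.
have: 0 < (j + 1) * ((P + 8) * (L0 - 2 * L1) - 10 * L0) by lia.
by rewrite pmulr_rgt0; lia.
Qed.

(** The opposite difference; the margin 2 pays for the sign term at [j = 0]. *)
Lemma bracket_up : 0 <= j -> j + 2 <= m -> 9 * (m - 1) <= P - 8 -> 0 <= L2 ->
  2 <= - ((P - 1) * L0) + (2 * P - 16) * L1 + 64 * L2.
Proof.
move=> j_ge0 le_jm big_P L2_ge0.
suff: 2 * L0 <= (P - 8) * (2 * L1 - L0) - 7 * L0 by lia.
have gap : L0 <= (j + 1) * (2 * L1 - L0).
  have: 0 <= (m * (m - 1 - j) + (m + j - 1) * (m - j - 2)) * L0.
    by apply: mulr_ge0; nia.
  have -> : (m * (m - 1 - j) + (m + j - 1) * (m - j - 2)) * L0 =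
    (m + j - 1) * ((j + 1) * (2 * L1 - L0) - L0).
    transitivity (2 * ((j + 1) * (m + j - 1) * L1) - (m + j - 1) * (j + 2) * L0);
      last by ring.
    by rewrite ratio; ring.
  by rewrite pmulr_rge0; lia.
have L1_big : 0 <= 2 * L1 - L0.
  by rewrite -(@pmulr_rge0 _ (j + 1)); lia.
have: 0 <= (P - 8 - 9 * (j + 1)) * (2 * L1 - L0) by apply: mulr_ge0; lia.
lia.
Qed.

(* At [m = j + 1] the leading terms cancel, and the comparison is decided by the
   exponentially smaller ones. *)
Lemma bracket_tie : 6 <= j -> m = j + 1 -> 0 < L1 ->
  (j + 2) * (m + j - 2) * L2 = (m - 2) * (m - 3) * L1 ->
  0 < - ((P - 1) * L0) + (2 * P - 16) * L1 + 64 * L2.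
Proof.
move=> j_ge6 def_m L1_gt0 ratio2.
have -> : L0 = 2 * L1.
  apply: (@mulfI _ (m * (m - 1))); first by nia.
  by rewrite -ratio def_m; ring.
(* The terms in [P] have cancelled. The claim amounts to [64 (j - 1) (j - 2) > 14 (j + 2) (2 j -
   1)], true from [j = 6] on but false at [j = 5], that is for [n = 3 j + 1 = 16], the end of the
   exceptional range. *)
suff: 0 < 64 * L2 - 14 * L1 by lia.
rewrite -(@pmulr_rgt0 _ ((j + 2) * (m + j - 2))); last by nia.
have -> : (j + 2) * (m + j - 2) * (64 * L2 - 14 * L1) =
  (64 * ((m - 2) * (m - 3)) - 14 * ((j + 2) * (m + j - 2))) * L1.
  transitivity (64 * ((j + 2) * (m + j - 2) * L2) - 14 * ((j + 2) * (m + j - 2)) * L1).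
    by ring.
  by rewrite ratio2; ring.
by rewrite def_m; apply: mulr_gt0 => //; nia.
Qed.

End Brackets.

(** * Comparison of consecutive genus coefficients for [n >= 19] *)

Lemma exp2_lower k : (7 <= k)%N -> 10 * (k%:R + 1) < 2 ^+ k + 8 :> int.
Proof.
elim: k => // k IHk; rewrite leq_eqVlt => /orP[/eqP<- // | k_gt6].
by have := IHk k_gt6; rewrite exprS -(natr1 k); lia.
Qed.

Lemma genus_coefS sg n m j : (n = m + j.*2)%N -> genus_coef sg n j.+1 =
  8 ^+ j * ((2 ^+ m - 1) * (lucas_coef n j)%:R + 8 * (lucas_coef n j.+1)%:R)
  - sg * (j == 0%N)%:R + pm2_coef n j.+1.
Proof.
move=> def_n; rewrite /genus_coef.
have -> : 2 ^+ (n + j) = 8 ^+ j * 2 ^+ m :> int.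
  by rewrite (_ : 8 = 2 ^+ 3) // -exprM -exprD; congr (_ ^+ _); lia.
by rewrite (exprS 8) eqSS /=; ring.
Qed.

Lemma lucas_coef_ratio_int n m j : (n = m + j.*2)%N -> (1 < m)%N ->
  (j%:R + 1) * (m%:R + j%:R - 1) * (lucas_coef n j.+1)%:R =
  m%:R * (m%:R - 1) * (lucas_coef n j)%:R :> int.
Proof.
case: m => [|[|m]] // def_n _; have /(congr1 (fun k => k%:R : int)) := lucas_coef_ratio def_n.
rewrite !natrM -addn1 -[(m + j).+1]addn1 -[m.+2]addn2 -[m.+1]addn1 !natrD => eq_r.
transitivity ((j%:R + 1) * (m%:R + j%:R + 1) * (lucas_coef n (j + 1))%:R : int).
  by rewrite addn1; ring.
by rewrite eq_r; ring.
Qed.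

Lemma genus_coef_down sg n m j : (19 <= n)%N -> (n = m + j.*2)%N -> (2 < m <= j)%N ->
  genus_coef sg n j.+2 < genus_coef sg n j.+1.
Proof.
case: m => [|[|[|m]]] // n_ge19 def_n /andP[_ le_mj].
have def_n1 : (n = m.+1 + j.+1.*2)%N by lia.
rewrite (genus_coefS _ def_n) (genus_coefS _ def_n1).
have -> : (j == 0%N) = false by lia.
rewrite [j.+1 == 0%N]/= mulr0 !subr0.
have rat0 := lucas_coef_ratio_int def_n isT.
have half1 : 2 * (lucas_coef n j.+2)%:R <= (lucas_coef n j.+1)%:R :> int.
  case: (posnP m) => [m0 | m_gt0]; first by rewrite lucas_coef_small; lia.
  apply: (ratio_le_half (j := j.+1%:R) (m := m.+1%:R)); last 2 first; try lia.
    by have := lucas_coef_gt0 (n := n) (j := j.+1); lia.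
  by apply: lucas_coef_ratio_int def_n1 _; lia.
have L0_gt0 : 0 < (lucas_coef n j)%:R :> int by have := lucas_coef_gt0 (n := n) (j := j); lia.
have big_P : 10 * (j%:R + 1) < (2 ^+ m.+3 + 8) * (1 + j%:R - m.+3%:R) :> int.
  have [m_ge4 | ] := leqP 4 m.
    have := @exp2_lower m.+3 m_ge4.
    set P := 2 ^+ _ => lowP.
    have: 0 <= (P + 8 - 10 * (m.+3%:R + 1) - 1) * (1 + j%:R - m.+3%:R).
      by apply: mulr_ge0; lia.
    have: 0 <= m.+3%:R * (j%:R - m.+3%:R) :> int by apply: mulr_ge0; lia.
    lia.
  (* When [n - 2 j] lies between 3 and 6, [n >= 19] forces [j >= 7], which settles each case. *)
  by case: m def_n le_mj {def_n1 rat0} => [|[|[|[|m]]]] // def_n le_mj _; rewrite -?natr1; lia.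
have := bracket_down L0_gt0 rat0 _ _ half1 big_P _.
set P := 2 ^+ m.+3 in big_P *; set L0 : int := (lucas_coef n j)%:R in L0_gt0 *.
move=> /(_ ltac:(lia) ltac:(lia) ltac:(lia)) pos.
have defP : P = 4 * 2 ^+ m.+1 by rewrite /P !exprS; ring.
(* Since [n <= 3 j], the reserved [8^j L0] covers the change in [pm2_coef], which is at most
   [2^n]. *)
have E_ge : 2 ^+ n <= 8 ^+ j :> int.
  by rewrite (_ : 8 = 2 ^+ 3) // -exprM ler_weXn2l //; lia.
have pm2_ge : pm2_coef n j.+2 - 2 ^+ n <= pm2_coef n j.+1.
  have n_expr : 2 ^+ n = 2 * 2 ^+ n.-1 :> int by rewrite -exprS prednK //; lia.
  have : 0 < 2 ^+ n.-1 :> int by rewrite exprn_gt0.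
  by rewrite /pm2_coef; do !case: eqP; lia.
have: 0 < 8 ^+ j * ((P - 2) * L0 + (16 - 2 * P) * (lucas_coef n j.+1)%:R -
                    64 * (lucas_coef n j.+2)%:R).
  by apply: mulr_gt0 => //; rewrite exprn_gt0.
have: 0 <= 8 ^+ j * (L0 - 1) by apply: mulr_ge0; [rewrite exprn_ge0 | lia].
by rewrite (exprS 8) defP; lia.
Qed.

Lemma genus_coef_up sg n m j :
    - 1 <= sg -> (19 <= n)%N -> (n = m + j.*2)%N -> (j < m)%N ->
  genus_coef sg n j.+1 < genus_coef sg n j.+2.
Proof.
move=> sg_ge n_ge19; case: m => [|[|[|m]]] // def_n lt_jm; try lia.
have def_n1 : (n = m.+1 + j.+1.*2)%N by lia.
rewrite (genus_coefS _ def_n) (genus_coefS _ def_n1).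
have rat0 := lucas_coef_ratio_int def_n isT.
have rat1 := lucas_coef_ratio_int def_n1 ltac:(lia).
have L0_gt0 : 0 < (lucas_coef n j)%:R :> int by have := lucas_coef_gt0 (n := n) (j := j); lia.
have L1_gt0 : 0 < (lucas_coef n j.+1)%:R :> int by have := lucas_coef_gt0 (n := n) (j := j.+1); lia.
have pow_ge : 10 * (m.+3%:R + 1) < 2 ^+ m.+3 + 8 :> int by apply: exp2_lower => //; lia.
set P := 2 ^+ m.+3 in pow_ge *; set L0 : int := (lucas_coef n j)%:R in L0_gt0 rat0 *.
have defP : P = 4 * 2 ^+ m.+1 by rewrite /P !exprS; ring.
have pm2_coef1 : pm2_coef n j.+1 = 0 by rewrite /pm2_coef; do 3 (case: eqP; [lia | move=> _]).
have pm2_coef2 : pm2_coef n j.+2 = 0 by rewrite /pm2_coef; do 3 (case: eqP; [lia | move=> _]).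
rewrite pm2_coef1 pm2_coef2 !addr0 [j.+1 == 0%N]/= mulr0 subr0.
have E_gt0 : 0 < 8 ^+ j :> int by rewrite exprn_gt0.
have [ge_m | lt_m] := leqP j.+2 m.+3.
  have := bracket_up (P := P) L0_gt0 rat0 _ _ _ _ (L2 := (lucas_coef n j.+2)%:R).
  move=> /(_ ltac:(lia) ltac:(lia) ltac:(lia) ltac:(lia)) pos.
  have: 0 <= 8 ^+ j * (- ((P - 1) * L0) + (2 * P - 16) * (lucas_coef n j.+1)%:R +
                       64 * (lucas_coef n j.+2)%:R - 2) by apply: mulr_ge0; lia.
  have: sg * (j == 0%N)%:R >= - 1 by case: eqP => _; lia.
  by rewrite (exprS 8) defP; lia.
(* Only the tie [n - 2 j = j + 1] is left, and [n >= 19] then gives [6 <= j]. *)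
have def_m : m = j.-2 by lia.
have eq_m : m.+3%:R = j%:R + 1 :> int by lia.
have pos : 0 < - ((P - 1) * L0) + (2 * P - 16) * (lucas_coef n j.+1)%:R +
    64 * (lucas_coef n j.+2)%:R.
  apply: (bracket_tie P L0_gt0 rat0 _ eq_m L1_gt0); first by lia.
  have -> : j%:R + 2 = j.+1%:R + 1 :> int by lia.
  have -> : m.+3%:R + j%:R - 2 = m.+1%:R + j.+1%:R - 1 :> int by lia.
  rewrite rat1.
  have -> : m.+3%:R = m.+1%:R + 2 :> int by lia.
  ring.
have: 0 < 8 ^+ j * (- ((P - 1) * L0) + (2 * P - 16) * (lucas_coef n j.+1)%:R +
                     64 * (lucas_coef n j.+2)%:R) by apply: mulr_gt0.
have -> : (j == 0%N) = false by lia.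
by rewrite (exprS 8) defP mulr0 subr0; lia.
Qed.

(** * From strict peaks of the coefficients to genus distributions *)

Definition strict_peak (a : nat -> int) (q r p : nat) : Prop :=
  [/\ (q <= p <= r)%N, 0 < a q /\ 0 < a r, forall i, (i < q)%N || (r < i)%N -> a i = 0,
      forall i, (q <= i < p)%N -> a i < a i.+1
    & forall i, (p <= i < r)%N -> a i.+1 < a i].

Lemma strict_peakP (G : mgraph) (a : nat -> int) q r p :
    (forall i, (genus_count G i)%:R = a i) -> strict_peak a q r p ->
  genus_unimodal G /\ genus_peak G p.
Proof.
move=> count_a [/andP[le_qp le_pr] [a_q a_r] a0 a_up a_down].
have [countE count_lt] : (forall i, a i = 0 -> genus_count G i = 0%N) /\
   (forall i k, a i < a k -> (genus_count G i < genus_count G k)%N).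
  by split=> [i | i k]; rewrite -!count_a; [move=> ? |]; lia.
have min_q : is_min_genus G q.
  split=> [|i]; first by have := count_a q; lia.
  by rewrite [(q <= i)%N]leqNgt; apply: contraL => lt_iq; rewrite countE // a0 ?lt_iq.
have max_r : is_max_genus G r.
  split=> [|i]; first by have := count_a r; lia.
  by rewrite [(i <= r)%N]leqNgt; apply: contraL => lt_ri; rewrite countE // a0 ?lt_ri ?orbT.
have peak_p : is_peak (genus_count G) q r p.
  split; first by rewrite le_qp leqnn.
  split=> //; split.
    by move=> i le_qi lt_ip; apply/ltnW/count_lt/a_up; rewrite le_qi ltnW.
  split=> [lt_qp|].
    by case: p lt_qp {le_qp le_pr a_down} a_up => // p lt_qp a_up; apply/count_lt/a_up/andP.
  split=> [i le_i|]; first by congr genus_count; lia.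
  split=> [lt_pr | i /andP[lt_pi lt_ir]].
    by apply/count_lt/a_down; rewrite leqnn.
  by apply/ltnW/count_lt/a_down; rewrite lt_ir ltnW.
by split; exists q, r; split=> //; exists p, p.
Qed.

Lemma genus_coef_gt_max sg n i : (1 < n)%N -> ((n.+1)./2 < i)%N -> genus_coef sg n i = 0.
Proof.
move=> n_gt1; case: i => // j lt_rj.
rewrite /genus_coef lucas_coef_small; last by lia.
have -> : pm2_coef n j.+1 = 0 by rewrite /pm2_coef; do 3 (case: eqP; [lia | move=> _]).
rewrite eqSS; have -> : (j == 0%N) = false by lia.
case: (ltnP n j.*2) => [lt_nj | le_jn]; first by rewrite (lucas_coef_small lt_nj); ring.
(* The remaining index has [n = 2 j], where [2^(n + j)] and [8^j] cancel. *)
have -> : n = (2 * j)%N by lia.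
have -> : (2 * j + j = 3 * j)%N by lia.
by rewrite (exprM 2 3 j) (_ : 2 ^+ 3 = 8) //; ring.
Qed.

Lemma genus_coef_0 sg n : (2 < n)%N -> genus_coef sg n 0 = 1 + sg.
Proof.
move=> n_gt2; rewrite /genus_coef.
have -> : pm2_coef n 0 = 0 by rewrite /pm2_coef; do 3 (case: eqP; [lia | move=> _]).
by case: n n_gt2 => // n _; rewrite lucas_coef0 /=; ring.
Qed.

Lemma genus_coef_max_gt0 sg n : (4 < n)%N -> 0 < genus_coef sg n n.+1./2.
Proof.
move=> n_gt4.
have [m [j [def_n def_r m12]]] : exists m j, [/\ n = (m + j.*2)%N, n.+1./2 = j.+1
    & m = 1%N \/ m = 2].
  exists (if odd n then 1%N else 2), n.+1./2.-1; case: ifP; split; lia.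
rewrite def_r (genus_coefS _ def_n).
have L0_gt0 : 0 < (lucas_coef n j)%:R :> int by have := lucas_coef_gt0 (n := n) (j := j); lia.
have E_gt0 : 0 < 8 ^+ j :> int by rewrite exprn_gt0.
have -> : (j == 0%N) = false by lia.
rewrite /pm2_coef; case: m12 def_n => -> def_n.
  do 3 (case: eqP; [lia | move=> _]).
  have: 0 <= 8 ^+ j * (lucas_coef n j.+1)%:R :> int by apply: mulr_ge0; lia.
  have: 0 < 8 ^+ j * (lucas_coef n j)%:R :> int by apply: mulr_gt0.
  by rewrite expr1; lia.
(* For [n - 2 j = 2] the small term is [-3 * 2^(n - 1)]; the factor [2^2 - 1] in front of [L0]
   compensates it, as [2^(n - 1) <= 8^j]. *)
case: eqP => [|_]; first by lia.
case: eqP => [_|]; last by lia.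
have L1_gt0 : 0 < (lucas_coef n j.+1)%:R :> int by have := lucas_coef_gt0 (n := n) (j := j.+1); lia.
have: 0 < 8 ^+ j * (lucas_coef n j.+1)%:R :> int by apply: mulr_gt0.
have: 0 <= 8 ^+ j * ((lucas_coef n j)%:R - 1) :> int by apply: mulr_ge0; lia.
have: 2 ^+ n.-1 <= 8 ^+ j :> int.
  by rewrite (_ : 8 = 2 ^+ 3) // -exprM ler_weXn2l //; lia.
by rewrite expr2; lia.
Qed.

Lemma genus_coef_0_lt_1 sg n : - 1 <= sg <= 1 -> (18 < n)%N ->
  genus_coef sg n 0 < genus_coef sg n 1.
Proof.
move=> sg_bound n_gt18.
rewrite genus_coef_0 ?(genus_coefS _ (m := n)) //; try lia.
have -> : pm2_coef n 1 = 0 by rewrite /pm2_coef; do 3 (case: eqP; [lia | move=> _]).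
have luc_n0 : lucas_coef n 0 = 1%N by case: n n_gt18 => // n _; rewrite lucas_coef0.
by have := @exp2_lower n ltac:(lia); rewrite expr0 luc_n0 /=; lia.
Qed.

Lemma strict_peak_large sg q n : - 1 <= sg <= 1 -> (18 < n)%N ->
  0 < genus_coef sg n q -> (forall i, (i < q)%N -> genus_coef sg n i = 0) -> (q <= 1)%N ->
  strict_peak (genus_coef sg n) q n.+1./2 (ladder_peak n).
Proof.
move=> sg_bound n_gt18 coef_q coef_lt_q q_le1.
have def_p : ladder_peak n = ((n + 2) %/ 3).+1.
  by rewrite /ladder_peak; do 2 (case: leqP; [lia | move=> _]); rewrite addn1.
rewrite def_p; split.
- by lia.
- by split=> //; apply: genus_coef_max_gt0; lia.
- move=> i /orP[/coef_lt_q // | gt_i]; apply: genus_coef_gt_max gt_i; lia.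
- move=> [|j] /andP[_ lt_jp]; first exact: genus_coef_0_lt_1.
  (* Genus [j + 1] lies below the peak exactly when [3 j + 1 <= n], that is [j < n - 2 j]. *)
  by apply: (@genus_coef_up _ _ (n - j.*2)%N); lia.
case=> [|j] /andP[le_pj lt_jr]; first by lia.
by apply: (@genus_coef_down _ _ (n - j.*2)%N); lia.
Qed.

(* A copy of [genus_coef] in binary arithmetic, since the unary [int] is useless
   for evaluating the cases [n <= 18]. *)
Section BinaryCoefficients.
Local Open Scope Z_scope.

Definition genus_coefZ (sg : Z) (n i : nat) : Z :=
  let pow b k := Z.pow b (Z.of_nat k) in
  (pow 8 i * Z.of_nat (lucas_coef n i)
   + (if i is j.+1 then (pow 2 (n + j)%N - pow 8 j) * Z.of_nat (lucas_coef n j) else 0)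
   + (if i is 0%N then sg else if i is 1%N then - sg else 0)
   + (if i.*2.+2 == n then pow 2 n.-1 else if i.*2 == n then - 3 * pow 2 n.-1
      else if i.*2.+1 == n then pow 2 n else 0)).

End BinaryCoefficients.

Lemma Z_of_intX (b : int) k : Z_of_int (b ^+ k) = Z.pow (Z_of_int b) (Z.of_nat k).
Proof.
elim: k => // k IHk; rewrite Nat2Z.inj_succ Z.pow_succ_r -?IHk.
  by rewrite exprS (rmorphM Z_of_int).
exact: Nat2Z.is_nonneg.
Qed.

Lemma Z_of_int_nat k : Z_of_int k%:R = Z.of_nat k.
Proof. by lia. Qed.

Lemma genus_coefZE sg n i : Z_of_int (genus_coef sg n i) = genus_coefZ (Z_of_int sg) n i.
Proof.
have addE a b c d x y z t : Z_of_int a = x -> Z_of_int b = y -> Z_of_int c = z ->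
    Z_of_int d = t -> Z_of_int (a + b + c + d) = Z.add (Z.add (Z.add x y) z) t.
  by move=> <- <- <- <-; rewrite !(rmorphD Z_of_int).
rewrite /genus_coef /genus_coefZ; apply: addE.
- by rewrite (rmorphM Z_of_int) /= Z_of_intX ?Z_of_int_nat.
- by case: i => // j; rewrite (rmorphM Z_of_int) (rmorphB Z_of_int) /= !Z_of_intX !Z_of_int_nat.
- by case: i => [|[|i]]; lia.
rewrite /pm2_coef; do 2 (case: ifP => _; first by rewrite ?(rmorphM Z_of_int) /= Z_of_intX).
by case: ifP => _; rewrite ?Z_of_intX.
Qed.

Definition strict_peakb (a : nat -> Z) (q r p : nat) : bool :=
  [&& (q <= p <= r)%N, Z.ltb Z0 (a q) && Z.ltb Z0 (a r),
      all (fun i => Z.eqb (a i) Z0) (iota 0 q),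
      all (fun i => Z.ltb (a i) (a i.+1)) (iota q (p - q)) &
      all (fun i => Z.ltb (a i.+1) (a i)) (iota p (r - p))].

(** Vanishing above the maximum genus comes from [genus_coef_gt_max] for infinitely many indices at
    once, so the test is finite. *)
Lemma strict_peak_small sg q n : (1 < n)%N ->
    strict_peakb (genus_coefZ (Z_of_int sg) n) q n.+1./2 (ladder_peak n) ->
  strict_peak (genus_coef sg n) q n.+1./2 (ladder_peak n).
Proof.
move=> n_gt1 /and5P[le_p /andP[a_q a_r] /allP a0 /allP a_up /allP a_down].
have ltE i k : Z.ltb (genus_coefZ (Z_of_int sg) n i) (genus_coefZ (Z_of_int sg) n k) ->
    genus_coef sg n i < genus_coef sg n k.
  by rewrite -!genus_coefZE; lia.
split=> //.
- by move: a_q a_r; rewrite -!genus_coefZE; lia.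
- move=> i /orP[lt_iq | ]; last exact: genus_coef_gt_max.
  by have := a0 i; rewrite mem_iota add0n lt_iq -genus_coefZE => /(_ isT); lia.
- by move=> i lt_ip; apply/ltE/a_up; rewrite mem_iota; lia.
by move=> i lt_ir; apply/ltE/a_down; rewrite mem_iota; lia.
Qed.

(** * The peaks of the two families *)

Lemma strict_peak_CL n : (1 < n)%N ->
  strict_peak (genus_coef 1 n) 0 n.+1./2 (ladder_peak n).
Proof.
move=> n_gt1; have [n_gt18 | n_le18] := ltnP 18 n.
  by apply: strict_peak_large => //; rewrite genus_coef_0 //; lia.
apply: strict_peak_small => //.
(* The values from 2 to 18 are evaluated; the general comparison takes over at 19. *)
have /allP : all (fun n =>
    strict_peakb (genus_coefZ (Z_of_int 1) n) 0 n.+1./2 (ladder_peak n))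
   (iota 2 17) by vm_compute.
by apply; rewrite mem_iota; lia.
Qed.

(** The boolean [2 < n] serves as the minimum genus: 0 for the complete graph on four vertices,
    which is the case [n = 2], and 1 afterwards. *)
Lemma strict_peak_ML n : (1 < n)%N ->
  strict_peak (genus_coef (- 1) n) (2 < n)%N n.+1./2 (ladder_peak n).
Proof.
move=> n_gt1; have [n_gt18 | n_le18] := ltnP 18 n.
  rewrite (_ : (2 < n)%N = true); last by lia.
  have coef0 : genus_coef (- 1) n 0 = 0 by rewrite genus_coef_0 ?subrr //; lia.
  apply: strict_peak_large => //; first by rewrite -{1}coef0; apply: genus_coef_0_lt_1.
  by case.
apply: strict_peak_small => //.
have /allP : all (fun n =>
    strict_peakb (genus_coefZ (Z_of_int (-1)) n) (2 < n)%N n.+1./2 (ladder_peak n))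
   (iota 2 17) by vm_compute.
by apply; rewrite mem_iota; lia.
Qed.

Local Close Scope ring_scope.

Theorem corollary4p6 (n : nat) (hn : 2 <= n) :
  [/\ genus_unimodal (CL n), genus_unimodal (ML n),
      genus_peak (CL n) (ladder_peak n)
    & genus_peak (ML n) (ladder_peak n)].
Proof.
have n_gt0 : 0 < n by lia.
have [uCL pCL] := strict_peakP (fun i => CL_genus_count i n_gt0) (strict_peak_CL hn).
have [uML pML] := strict_peakP (fun i => ML_genus_count i n_gt0) (strict_peak_ML hn).
by split.
Qed.
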